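(* Let $R=\bigoplus_{\alpha\in\Gamma}R_{\alpha}$ be a graded integral domain and let $\star$ be a semistar operation on $R$ such that $R^{\star}\subsetneq R_H$ and $\star$ is homogeneous preserving. Then (1) $\mathrm{KR}(R,\star)=\mathrm{KR}(R,\star_a)$; (2) $\mathrm{KR}(R,\star)$ is a Bézout domain; (3) $I^{\star_a}=I\,\mathrm{KR}(R,\star)\cap R_H$ for every nonzero finitely generated homogeneous ideal $I$ of $R$.
   Context: $\Gamma$ is a commutative cancellative monoid (written additively) whose quotient group $\langle\Gamma\rangle$ is torsion-free. A graded integral domain $R=\bigoplus_{\alpha\in\Gamma}R_\alpha$ is an integral domain that is the direct sum of additive subgroups $R_\alpha$ with $R_\alpha R_\beta\subseteq R_{\alpha+\beta}$. $K$ is its quotient field, $H$ the set of nonzero homogeneous elements of $R$, $R_H$ the homogeneous quotient field. An ideal $I$ is homogeneous if $I=\bigoplus_\alpha(I\cap R_\alpha)$; a fractional ideal $I$ is homogeneous if $sI$ is a homogeneous ideal of $R$ for some $s\in H$. For $a\in R_H$, $C(a)$ is the $R$-submodule generated by the homogeneous components of $a$; for $f=f_0+\cdots+f_nX^n\in R[X]$, $A_f:=\sum_i C(f_i)$. A semistar operation on $R$ is a map $\star$ from the set $\overline{\mathcal F}(R)$ of nonzero $R$-submodules of $K$ to itself such that for all $0\ne x\in K$ and $E,F$: $(xE)^\star=xE^\star$; $E\subseteq F\Rightarrow E^\star\subseteq F^\star$; $E\subseteq E^\star$; $(E^\star)^\star=E^\star$. It is homogeneous preserving if it sends homogeneous fractional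 ideals to homogeneous fractional ideals. With $f(R)$ the set of nonzero finitely generated fractional ideals and $(A:B)=\{x\in K:xB\subseteq A\}$, $\star_a$ is defined by $F^{\star_a}=\bigcup\{((FG)^\star:G^\star): G\in f(R)\}$ for $F\in f(R)$ and $E^{\star_a}=\bigcup\{F^{\star_a}: F\in f(R),F\subseteq E\}$ for $E\in\overline{\mathcal F}(R)$. $\mathrm{KR}(R,\star):=\{f/g: f,g\in R[X], g\neq0$, and there is $0\ne h\in R[X]$ with $A_fA_h\subseteq (A_gA_h)^\star\}\subseteq K(X)$. *)

(* Defs.v *)
From HB Require Import structures.
From mathcomp Require Import all_boot all_order all_algebra fraction.
Set Implicit Arguments.
Unset Strict Implicit.
Unset Printing Implicit Defensive.
Import Order.TTheory GRing.Theory Num.Theory.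
Local Open Scope ring_scope.

Definition subs (T : Type) (A B : T -> Prop) := forall x, A x -> B x.
Definition seteq (T : Type) (A B : T -> Prop) := forall x, A x <-> B x.

Section Generic.
Variable F : fieldType.

Definition subring (S : F -> Prop) :=
  [/\ S 0, S 1, (forall x y, S x -> S y -> S (x - y))
    & (forall x y, S x -> S y -> S (x * y))].

Definition span (S : F -> Prop) (s : seq F) : F -> Prop :=
  fun y => exists c : nat -> F,
    (forall i, S (c i)) /\ y = \sum_(i < size s) c i * s`_i.

Definition bezout_subring (S : F -> Prop) :=
  subring S /\
  forall s : seq F, (forall x, x \in s -> S x) ->
    exists d, S d /\ seteq (span S s) (span S [:: d]).

Definition submod (S E : F -> Prop) :=
  [/\ E 0, (forall x y, E x -> E y -> E (x + y))
    & (forall r x, S r -> E x -> E (r * x))].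

Definition nonzero (E : F -> Prop) := exists x, E x /\ x != 0.

Definition fgnz (S E : F -> Prop) :=
  nonzero E /\ exists s : seq F, seteq E (span S s).

Definition prodm (E1 E2 : F -> Prop) : F -> Prop :=
  fun y => exists (n : nat) (a b : nat -> F),
    (forall i, E1 (a i) /\ E2 (b i)) /\ y = \sum_(i < n) a i * b i.

Definition scale (x : F) (E : F -> Prop) : F -> Prop :=
  fun y => exists z, E z /\ y = x * z.

Definition semistar (R : F -> Prop) (star : (F -> Prop) -> (F -> Prop)) :=
  forall E E' : F -> Prop,
    submod R E -> nonzero E -> submod R E' -> nonzero E' ->
  [/\ submod R (star E) /\ nonzero (star E),
      (forall x, x != 0 -> seteq (star (scale x E)) (scale x (star E))),
      (subs E E' -> subs (star E) (star E')),
      subs E (star E)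
    & seteq (star (star E)) (star E)].

Definition star_a_fg (R : F -> Prop) (star : (F -> Prop) -> (F -> Prop))
    (E : F -> Prop) : F -> Prop :=
  fun x => exists Gm : F -> Prop, fgnz R Gm /\
    forall y, star Gm y -> star (prodm E Gm) (x * y).

Definition star_a (R : F -> Prop) (star : (F -> Prop) -> (F -> Prop))
    (E : F -> Prop) : F -> Prop :=
  fun x => exists E0 : F -> Prop, fgnz R E0 /\ subs E0 E /\ star_a_fg R star E0 x.

End Generic.

Section Graded.
Variables (K : fieldType) (G : zmodType).
Variables (Gam : G -> Prop) (R : K -> Prop) (Rc : G -> K -> Prop).

Definition hdecomp (r : K) (d : seq (G * K)) :=
  [/\ uniq (map fst d),
      (forall p, p \in d -> Gam p.1 /\ Rc p.1 p.2)
    & r = \sum_(p <- d) p.2].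

Definition graded_domain :=
  [/\ (forall (n : nat) (x : G), (0 < n)%N -> x *+ n = 0 -> x = 0),
      Gam 0 /\ (forall a b, Gam a -> Gam b -> Gam (a + b)),
      subring R,
      (forall x : K, exists a b, [/\ R a, R b, b != 0 & x = a / b])
    & (forall a, [/\ Rc a 0, (forall x y, Rc a x -> Rc a y -> Rc a (x - y)),
                  subs (Rc a) R & (~ Gam a -> forall x, Rc a x -> x = 0)])
  ] /\ [/\
      (forall a b x y, Rc a x -> Rc b y -> Rc (a + b) (x * y)),
      (forall r, R r -> exists d, hdecomp r d)
    & (forall d, hdecomp 0 d -> forall p, p \in d -> p.2 = 0)].

Definition homog (x : K) := x != 0 /\ exists a, Gam a /\ Rc a x.

Definition RH (x : K) := exists a s, R a /\ homog s /\ x = a / s.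

(* C(a): R-submodule generated by the homogeneous components of a in R_H
   (a = r/s with s in H, r = sum of its components r_b; components r_b/s) *)
Definition Ccont (a : K) : K -> Prop :=
  fun x => exists s d, homog s /\ hdecomp (a * s) d /\
    span R [seq p.2 / s | p <- d] x.

Definition polyR (f : {poly K}) := forall i, R f`_i.

Definition Af (f : {poly K}) : K -> Prop :=
  fun x => exists c : nat -> K,
    (forall i, (i < size f)%N -> Ccont f`_i (c i)) /\
    x = \sum_(i < size f) c i.

Definition KR (star : (K -> Prop) -> (K -> Prop)) : {fraction {poly K}} -> Prop :=
  fun q => exists f g h : {poly K},
    [/\ polyR f, polyR g, polyR h, g != 0 & h != 0] /\
        q = FracField.tofrac f / FracField.tofrac g
      /\ subs (prodm (Af f) (Af h)) (star (prodm (Af g) (Af h))).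

Definition homog_ideal (I : K -> Prop) :=
  [/\ submod R I, subs I R &
      forall r d, I r -> hdecomp r d -> forall p, p \in d -> I p.2].

Definition homog_frac (E : K -> Prop) :=
  [/\ submod R E, nonzero E & exists s, homog s /\ homog_ideal (scale s E)].

Definition homog_preserving (star : (K -> Prop) -> (K -> Prop)) :=
  forall E, homog_frac E -> homog_frac (star E).

Definition cst (x : K) : {fraction {poly K}} := FracField.tofrac (x%:P).

Definition ext_ideal (S : {fraction {poly K}} -> Prop) (I : K -> Prop) :
    {fraction {poly K}} -> Prop :=
  fun y => exists (n : nat) (c : nat -> {fraction {poly K}}) (a : nat -> K),
    (forall k, S (c k) /\ I (a k)) /\ y = \sum_(k < n) c k * cst (a k).

End Graded.

(* Main.v *)
Require Import Defs.
From HB Require Import structures.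
From mathcomp Require Import all_boot all_order all_algebra fraction boolp.
From mathcomp Require Import zify ring.
Set Implicit Arguments.
Unset Strict Implicit.
Unset Printing Implicit Defensive.
Import Order.TTheory GRing.Theory Num.Theory.
Local Open Scope ring_scope.

(* For [f, g] in [R[X]] some nonzero finitely generated homogeneous module [P]
   satisfies [A_f A_g P = A_fg P]: a map from the degrees occurring in [f] and
   [g] to the natural numbers that is faithful on sums of two degrees turns this
   into the Dedekind-Mertens lemma for one variable.  As every such [P] is the
   content of a polynomial, a quotient [f / g] lies in [KR] as soon as
   [A_f T <= (A_g T)^star] for a homogeneous [T], so [KR] is a ring, and [f]
   and [f'] generate the same ideal as [f + f' X^(size f)].

   For [star_a], let [x G <= (I G)^star] with [I] homogeneous.  Since [star]
   preserves homogeneity, [G] may be replaced by its content when [x] is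
   homogeneous.  For general [x], [G] only gives [c x^n] in [R_H] for all [n],
   and [x] lies in [R_H] because [R_H] is completely integrally closed. *)

(** * Submodules as an idempotent semiring *)

(** Torsion-freeness of the group enters only through finite sets of degrees, placed in some Z^k and
    then read as integers in a large enough radix. The powers [c x^n] arise as follows. As [I] lies
    in [R], [x G <= (I G)^star <= G^star], so every [x^n] maps [G] into [G^star]; scaling [G] into
    [R] puts [c x^n] into [R^star], hence into [R_H]. Complete integral closedness of [R_H] is then
    a division of [a] by [c], where [x = a / c], leading term by leading term. The difficulty is
    termination: the supports must stay in a bounded region of Z^k, and this is what the hypothesis
    on all powers of [x] provides. Membership of [x] in [R_H] does not finish (3), because for an
    inhomogeneous [x = r / s] the components of [x b_i] mix and the witness cannot be replaced by
    its content. There the cancellation of contents is applied once more, to the numerator [r] and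
    to the polynomial formed from the generators of the witness. *)

Definition smod (F : fieldType) (R : F -> Prop) (hR : subring R) :=
  {E : F -> Prop | submod R E}.

Definition mem_smod F R hR (M : @smod F R hR) : F -> Prop := sval M.
Coercion mem_smod : smod >-> Funclass.

HB.instance Definition _ F R hR := gen_eqMixin (@smod F R hR).
HB.instance Definition _ F R hR := gen_choiceMixin (@smod F R hR).

Section Submodules.
Variables (F : fieldType) (R : F -> Prop) (hR : subring R).
Implicit Types (M N P : smod hR) (x y : F).

Lemma subring0 : R 0. Proof. by case: hR. Qed.
Lemma subring1 : R 1. Proof. by case: hR. Qed.
Lemma subringB x y : R x -> R y -> R (x - y). Proof. by case: hR => _ _ h _; apply: h. Qed.
Lemma subringM x y : R x -> R y -> R (x * y). Proof. by case: hR => _ _ _; apply. Qed.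
Lemma subringN x : R x -> R (- x).
Proof. by rewrite -sub0r; apply: subringB subring0. Qed.
Lemma subringD x y : R x -> R y -> R (x + y).
Proof. by move=> hx /subringN; rewrite -{2}[y]opprK; apply: subringB. Qed.
Lemma subring_sum I (r : seq I) (P : pred I) (f : I -> F) :
  (forall i, P i -> R (f i)) -> R (\sum_(i <- r | P i) f i).
Proof. by move=> h; apply: big_ind h; [exact: subring0 | exact: subringD]. Qed.

Lemma smod0 M : M 0. Proof. by case: (svalP M). Qed.
Lemma smodD M x y : M x -> M y -> M (x + y). Proof. by case: (svalP M) => _ h _; apply: h. Qed.
Lemma smodZ M r x : R r -> M x -> M (r * x). Proof. by case: (svalP M) => _ _; apply. Qed.
Lemma smodN M x : M x -> M (- x).
Proof. by rewrite -mulN1r; apply/smodZ/subringN/subring1. Qed.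
Lemma smod_sum M I (r : seq I) (P : pred I) (f : I -> F) :
  (forall i, P i -> M (f i)) -> M (\sum_(i <- r | P i) f i).
Proof. by move=> h; apply: big_ind h; [exact: smod0 | exact: smodD]. Qed.
Lemma smod_sum_seq M (I : eqType) (r : seq I) (P : pred I) (f : I -> F) :
  (forall i, i \in r -> P i -> M (f i)) -> M (\sum_(i <- r | P i) f i).
Proof. by move=> h; rewrite big_seq_cond; apply: smod_sum => i /andP[]; apply: h. Qed.

Lemma smod_ext M N : seteq M N -> M = N.
Proof.
case: M N => M hM [N hN] h; have e : M = N by rewrite predeqE.
by case: N / e hN h => hN _; congr exist; apply: Prop_irrelevance.
Qed.

Lemma smod_zero_subproof : submod R (fun x => x = 0).
Proof. by split=> [//|x y -> ->|r x _ ->]; rewrite ?addr0 ?mulr0. Qed.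
Lemma smod_one_subproof : submod R R.
Proof. by split; [exact: subring0 | exact: subringD | exact: subringM]. Qed.
Lemma smod_add_subproof M N : submod R (fun z => exists x y, [/\ M x, N y & z = x + y]).
Proof.
split=> [|_ _ [x [y [hx hy ->]]] [x' [y' [hx' hy' ->]]]|r _ hr [x [y [hx hy ->]]]].
- by exists 0, 0; split; rewrite ?addr0 //; apply: smod0.
- by exists (x + x'), (y + y'); split; rewrite 1?addrACA //; apply: smodD.
- by exists (r * x), (r * y); split; rewrite ?mulrDr //; apply: smodZ.
Qed.

Lemma prodm_min (E1 E2 : F -> Prop) (T : F -> Prop) :
  T 0 -> (forall x y, T x -> T y -> T (x + y)) ->
  (forall x y, E1 x -> E2 y -> T (x * y)) -> subs (prodm E1 E2) T.
Proof.
move=> T0 TD h _ [n [a [b [hab ->]]]].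
by apply: big_ind => // i _; apply: h; case: (hab i).
Qed.

Lemma prodm_in (E1 E2 : F -> Prop) x y : E1 x -> E2 y -> prodm E1 E2 (x * y).
Proof.
by move=> hx hy; exists 1, (fun=> x), (fun=> y); split=> //; rewrite big_ord1.
Qed.

Lemma smod_mul_subproof M N : submod R (prodm M N).
Proof.
split=> [|x y [n [a [b [hab ->]]]] [m [c [d [hcd ->]]]]|r x hr].
- by rewrite -[X in prodm _ _ X](mul0r 0); apply: prodm_in; exact: smod0.
- exists (n + m)%N, (fun i => if (i < n)%N then a i else c (i - n)%N).
  exists (fun i => if (i < n)%N then b i else d (i - n)%N).
  split=> [i|]; first by case: ifP.
  rewrite big_split_ord; congr (_ + _); apply: eq_bigr => i _ /=.
    by rewrite ltn_ord.
  by rewrite ltnNge leq_addr /= addKn.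
- case=> n [a [b [hab ->]]]; exists n, (fun i => r * a i), b.
  split=> [i|]; first by case: (hab i) => ? ?; split=> //; apply: smodZ.
  by rewrite mulr_sumr; apply: eq_bigr => i _; rewrite mulrA.
Qed.

Definition smod_zero : smod hR := exist _ _ smod_zero_subproof.
Definition smod_one : smod hR := exist _ _ smod_one_subproof.
Definition smod_add M N : smod hR := exist _ _ (smod_add_subproof M N).
Definition smod_mul M N : smod hR := exist _ _ (smod_mul_subproof M N).

Lemma smod_mul_min M N P :
  (forall x y, M x -> N y -> P (x * y)) -> subs (smod_mul M N) P.
Proof. by apply: prodm_min; [exact: smod0 | exact: smodD]. Qed.

Lemma smod_addA : associative smod_add.
Proof.
move=> M N P; apply: smod_ext => z; split.
  case=> x [_ [hx [y [w [hy hw ->]]] ->]].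
  by exists (x + y), w; split=> //; [exists x, y | rewrite addrA].
case=> _ [w [[x [y [hx hy ->]]] hw ->]].
by exists x, (y + w); split=> //; [exists y, w | rewrite addrA].
Qed.
Lemma smod_addC : commutative smod_add.
Proof.
by move=> M N; apply: smod_ext => z; split=> -[x [y [hx hy ->]]];
  exists y, x; rewrite addrC.
Qed.
Lemma smod_add0 : left_id smod_zero smod_add.
Proof.
move=> M; apply: smod_ext => z; split=> [[_ [y [-> hy ->]]]|hz]; first by rewrite add0r.
by exists 0, z; split; rewrite ?add0r.
Qed.
Lemma smod_mulC : commutative smod_mul.
Proof.
suff h M N : subs (smod_mul M N) (smod_mul N M) by move=> M N; apply: smod_ext; split; apply: h.
by apply: smod_mul_min => x y hx hy; rewrite mulrC; apply: prodm_in.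
Qed.
Lemma smod_mulA : associative smod_mul.
Proof.
suff h M N P : subs (smod_mul (smod_mul M N) P) (smod_mul M (smod_mul N P)).
  move=> M N P; apply: smod_ext => z; split; last exact: h.
  have := @h P N M z.
  by rewrite smod_mulC (smod_mulC P N) (smod_mulC P) (smod_mulC N M).
apply: smod_mul_min => w y hw hy; move: w hw.
apply: (@prodm_min M N (fun x => smod_mul M (smod_mul N P) (x * y))).
- by rewrite mul0r; apply: smod0.
- by move=> u v hu hv; rewrite mulrDl; apply: smodD.
- by move=> u v hu hv; rewrite -mulrA; apply/prodm_in/prodm_in.
Qed.
Lemma smod_mul1 : left_id smod_one smod_mul.
Proof.
move=> M; apply: smod_ext => z; split.
  by apply: smod_mul_min; exact: smodZ.
by move=> hz; rewrite -[z]mul1r; apply: prodm_in => //; apply: subring1.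
Qed.
Lemma smod_mulDl : left_distributive smod_mul smod_add.
Proof.
move=> M N P; apply: smod_ext => z; split.
  move: z; apply: smod_mul_min => _ w [x [y [hx hy ->]]] hw.
  by exists (x * w), (y * w); split; rewrite ?mulrDl //; apply: prodm_in.
case=> x [y [hx hy ->]]; apply: smodD; [move: x hx|move: y hy];
  apply: smod_mul_min => u w hu hw; apply: prodm_in => //.
  by exists u, 0; split; rewrite ?addr0 //; apply: smod0.
by exists 0, u; split; rewrite ?add0r //; apply: smod0.
Qed.
Lemma smod_mul0 : left_zero smod_zero smod_mul.
Proof.
move=> M; apply: smod_ext => z; split=> [|->]; last exact: smod0.
by move: z; apply: smod_mul_min => x y -> _; rewrite mul0r.
Qed.
End Submodules.

(** With these instances, products and sums of submodules are rearranged by [ring] in the content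
    estimates below. *)
HB.instance Definition _ F R hR := GRing.isNmodule.Build (@smod F R hR)
  (@smod_addA F R hR) (@smod_addC F R hR) (@smod_add0 F R hR).
HB.instance Definition _ F R hR := GRing.Nmodule_isComPzSemiRing.Build (@smod F R hR)
  (@smod_mulA F R hR) (@smod_mulC F R hR) (@smod_mul1 F R hR) (@smod_mulDl F R hR)
  (@smod_mul0 F R hR).

Notation "M <=: N" := (subs (mem_smod M%R) (mem_smod N%R)) (at level 70).

(** * Principal submodules and the Dedekind-Mertens lemma *)

Section Principal.
Variables (F : fieldType) (R : F -> Prop) (hR : subring R).
Implicit Types (M N P Q : smod hR) (x y : F).

Lemma smod_sub_trans N M P : M <=: N -> N <=: P -> M <=: P.
Proof. by move=> h1 h2 x /h1 /h2. Qed.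
Lemma smod_sub_refl M : M <=: M. Proof. by []. Qed.
Lemma smod_sub_anti M N : M <=: N -> N <=: M -> M = N.
Proof. by move=> h1 h2; apply: smod_ext; split; [apply: h1|apply: h2]. Qed.
Lemma smod_sub0 M : (0 : smod hR) <=: M. Proof. by move=> _ ->; apply: smod0. Qed.
Lemma smod_addl M N : M <=: M + N.
Proof. by move=> x hx; exists x, 0; split; rewrite ?addr0 //; apply: smod0. Qed.
Lemma smod_addr M N : N <=: M + N.
Proof. by rewrite addrC; apply: smod_addl. Qed.
Lemma smod_add_min M N P : M <=: P -> N <=: P -> M + N <=: P.
Proof. by move=> h1 h2 _ [x [y [/h1 hx /h2 hy ->]]]; apply: smodD. Qed.
Lemma smod_addS M N P Q : M <=: P -> N <=: Q -> M + N <=: P + Q.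
Proof.
move=> h1 h2; apply: smod_add_min.
  exact: smod_sub_trans h1 (@smod_addl _ _).
exact: smod_sub_trans h2 (@smod_addr _ _).
Qed.
Lemma smod_mulP M N P : (forall x y, M x -> N y -> P (x * y)) -> M * N <=: P.
Proof. exact: smod_mul_min. Qed.
Lemma smod_mem_mul M N x y : M x -> N y -> mem_smod (M * N) (x * y).
Proof. exact: prodm_in. Qed.
Lemma smod_mulS M N P Q : M <=: P -> N <=: Q -> M * N <=: P * Q.
Proof.
by move=> h1 h2; apply: smod_mulP => x y /h1 hx /h2 hy; apply: smod_mem_mul.
Qed.
Lemma smod_expS M N k : M <=: N -> M ^+ k <=: N ^+ k.
Proof. by move=> h; elim: k => // k IH; rewrite !exprS; apply: smod_mulS. Qed.
Lemma smod_sub_sum (I : eqType) (r : seq I) (f : I -> smod hR) i :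
  i \in r -> f i <=: \sum_(j <- r) f j.
Proof.
elim: r => // j r IH; rewrite inE big_cons => /predU1P[->|/IH h].
  exact: smod_addl.
exact: smod_sub_trans h (@smod_addr _ _).
Qed.
Lemma smod_sum_min (I : eqType) (r : seq I) (f : I -> smod hR) M :
  (forall i, i \in r -> f i <=: M) -> \sum_(j <- r) f j <=: M.
Proof.
move=> h; rewrite big_seq; apply: (big_ind (fun N : smod hR => N <=: M)) => //.
  exact: smod_sub0.
by move=> N P; apply: smod_add_min.
Qed.

Lemma principal_subproof x : submod R (fun z => exists r, R r /\ z = r * x).
Proof.
split=> [|_ _ [r [hr ->]] [s [hs ->]]|r _ hr [s [hs ->]]].
- by exists 0; rewrite mul0r; split; first exact: subring0.
- by exists (r + s); rewrite mulrDl; split; first exact: subringD.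
- by exists (r * s); rewrite mulrA; split; first exact: subringM.
Qed.
Definition pr x : smod hR := exist _ _ (principal_subproof x).

Lemma pr_in x : pr x x.
Proof. by exists 1; rewrite mul1r; split; first exact: subring1. Qed.
Lemma pr_min M x : M x -> pr x <=: M.
Proof. by move=> hx _ [r [hr ->]]; apply: smodZ. Qed.
Lemma prM x y : pr (x * y) = pr x * pr y.
Proof.
apply: smod_sub_anti; first by apply/pr_min/smod_mem_mul; apply: pr_in.
apply: smod_mulP => _ _ [r [hr ->]] [s [hs ->]]; exists (r * s); split.
  exact: subringM.
by rewrite mulrACA.
Qed.
Lemma pr1 : pr 1 = 1.
Proof.
apply: smod_ext => z; split=> [[r [hr ->]]|hz]; first by rewrite mulr1.
by exists z; rewrite mulr1.
Qed.
Lemma pr0 : pr 0 = 0.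
Proof.
apply: smod_ext => z; split=> [[r [_ ->]]|->]; first by rewrite mulr0.
exact: smod0.
Qed.
Lemma prM_mem M x z : mem_smod (pr x * M) z <-> exists y, M y /\ z = x * y.
Proof.
split=> [|[y [hy ->]]]; last by apply: smod_mem_mul => //; apply: pr_in.
move: z; apply: (@prodm_min _ _ _ (fun z => exists y, M y /\ z = x * y)).
- by exists 0; rewrite mulr0; split=> //; apply: smod0.
- by move=> _ _ [y [hy ->]] [w [hw ->]]; exists (y + w); rewrite mulrDr; split=> //; apply: smodD.
- move=> _ y [r [hr ->]] hy; exists (r * y); split; first exact: smodZ.
  by rewrite mulrCA mulrA.
Qed.
Lemma smod_sub1 x : R x -> pr x <=: (1 : smod hR). Proof. by move=> hx; apply: pr_min. Qed.

Lemma smod_neq0 M x : M x -> x != 0 -> M != 0.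
Proof. by move=> hx x0; apply/negP => /eqP M0; rewrite M0 in hx; case/eqP: x0. Qed.
Lemma smod_neq0P M : M != 0 <-> nonzero M.
Proof.
split=> [M0|[x [hx x0]]]; last exact: smod_neq0 hx x0.
apply: contrapT => h; case/eqP: M0; apply: smod_ext => x; split=> [hx|->]; last exact: smod0.
by case: (eqVneq x 0) => // x0; case: h; exists x.
Qed.
Lemma smod_mul_neq0 M N : M != 0 -> N != 0 -> M * N != 0.
Proof.
move=> /smod_neq0P[x [hx x0]] /smod_neq0P[y [hy y0]].
by apply: (@smod_neq0 _ (x * y)); [apply: smod_mem_mul | rewrite mulf_neq0].
Qed.
Lemma smod1_neq0 : (1 : smod hR) != 0.
Proof. by apply: (@smod_neq0 _ 1); [apply: subring1 | apply: oner_neq0]. Qed.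
Lemma smod_exp_neq0 M k : M != 0 -> M ^+ k != 0.
Proof.
by move=> h; elim: k => [|k IH]; [exact: smod1_neq0 | rewrite exprS smod_mul_neq0].
Qed.
Lemma smod_sub_neq0 M N : M <=: N -> M != 0 -> N != 0.
Proof. by move=> h /smod_neq0P[x [/h hx x0]]; apply: smod_neq0 hx x0. Qed.
Lemma pr_neq0 x : x != 0 -> pr x != 0.
Proof. by apply: smod_neq0; apply: pr_in. Qed.

Lemma span_gen (s : seq F) : Defs.span R s = mem_smod (hR:=hR) (\sum_(x <- s) pr x).
Proof.
rewrite predeqE => z; split.
  case=> c [hc ->]; apply: smod_sum => i _; apply: smodZ => //.
  by apply: smod_sub_sum (mem_nth 0 (ltn_ord i)) _ _; apply: pr_in.
elim: s z => [z|x s IH z]; rewrite ?big_nil ?big_cons.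
  by move=> ->; exists (fun=> 0); rewrite big_ord0; split=> // _; apply: subring0.
case=> _ [y [[r [hr ->]] /IH[c [hc ->]] ->]].
exists (fun i => if i is j.+1 then c j else r); split=> [[]//|].
by rewrite big_ord_recl.
Qed.

(** A product of [k.+1] factors, each [M] or [N], is either all [M] or has a factor [N]; addition
    being idempotent, no binomial coefficients appear. *)
Lemma smod_exp_add M N k : (M + N) ^+ k.+1 <=: M ^+ k.+1 + N * (M + N) ^+ k.
Proof.
elim: k => [|k IH]; first by rewrite !expr1 expr0 mulr1.
rewrite [in X in X <=: _]exprS [X in X <=: _]mulrDl.
apply: smod_add_min; last exact: smod_addr.
apply: smod_sub_trans (smod_mulS (@smod_sub_refl _) IH) _.
rewrite mulrDr -exprS; apply: smod_addS => //.
rewrite mulrCA; apply: smod_mulS => //; rewrite exprS.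
by apply: smod_mulS => //; apply: smod_addl.
Qed.

Definition cont (f : {poly F}) : smod hR := \sum_(i <- iota 0 (size f)) pr f`_i.

Lemma cont_in (f : {poly F}) i : cont f f`_i.
Proof.
have [hi|hi] := ltnP i (size f); last by rewrite nth_default //; apply: smod0.
apply: (smod_sub_sum (f := fun i => pr f`_i)); last exact: pr_in.
by rewrite mem_iota.
Qed.
Lemma cont_min (f : {poly F}) M : (forall i, M f`_i) -> cont f <=: M.
Proof. by move=> h; apply: smod_sum_min => i _; apply: pr_min. Qed.

Lemma size_truncate (p : {poly F}) m :
  (size p <= m.+1)%N -> (size (p - p`_m *: 'X^m)%R <= m)%N.
Proof.
move=> hp; apply/leq_sizeP => j hj; rewrite coefB coefZ coefXn.
have [->|hjm] := eqVneq j m; first by rewrite mulr1 subrr.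
rewrite mulr0 subr0 nth_default //; apply: leq_trans hp _.
by rewrite ltn_neqAle eq_sym hjm.
Qed.

Lemma cont_truncate (p : {poly F}) m :
  cont p = cont (p - p`_m *: 'X^m) + pr p`_m.
Proof.
have hc i : (p - p`_m *: 'X^m)`_i = if i == m then 0 else p`_i.
  rewrite coefB coefZ coefXn; case: eqP => [->|_]; first by rewrite mulr1 subrr.
  by rewrite mulr0 subr0.
apply: smod_sub_anti.
  apply: cont_min => i; have [->|him] := eqVneq i m.
    by apply: smod_addr; apply: pr_in.
  by apply: smod_addl; have := cont_in (p - p`_m *: 'X^m) i; rewrite hc (negPf him).
apply: smod_add_min; last by apply/pr_min/cont_in.
apply: cont_min => i; rewrite hc; case: ifP => _; [exact: smod0 | exact: cont_in].
Qed.

Lemma contM_truncate (p q : {poly F}) m :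
  cont ((p - p`_m *: 'X^m) * q) <=: cont (p * q) + pr p`_m * cont q.
Proof.
apply: cont_min => i; rewrite mulrBl coefB; apply: smodD.
  by apply: smod_addl; apply: cont_in.
rewrite -scalerAl coefZ -mulrN; apply: smod_addr; apply: smod_mem_mul.
  exact: pr_in.
apply: smodN; rewrite coefXnM; case: ifP => _; [exact: smod0 | exact: cont_in].
Qed.

(* The Dedekind-Mertens inequality; both factors lose their top coefficients
   in turn, the product of which is the top coefficient of [f * g] *)
Lemma dedekind_mertens (f g : {poly F}) k :
  (size g <= k)%N -> cont f ^+ k * cont g <=: cont f ^+ k.-1 * cont (f * g).
Proof.
(* The outer induction shortens [f] and is free in [g] and [k]; the inner one shortens [g] for a
   fixed bound on [f]. *)
have [n] := ubnP (size f); elim: n k f g => // n IHn; elim=> [|k IHk] f g hf hg.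
  move: hg; rewrite leqn0 size_poly_eq0 => /eqP->.
  by rewrite mulr0 /cont size_poly0 big_nil mulr0.
case: n IHn hf IHk => [|n] IHn hf IHk.
  move: hf; rewrite ltnS leqn0 size_poly_eq0 => /eqP->.
  rewrite [cont 0]/cont size_poly0 big_nil exprS !mul0r; exact: smod_sub0.
rewrite -pred_Sn; set W := (X in _ <=: X).
pose b := g`_k; pose a := f`_n.
pose g1 := g - b *: 'X^k; pose f1 := f - a *: 'X^n.
have hg1 : (size g1 <= k)%N by apply: size_truncate.
have hf1 : (size f1 < n.+1)%N by apply: size_truncate.
have ef : cont f = cont f1 + pr a by apply: cont_truncate.
have eg : cont g = cont g1 + pr b by apply: cont_truncate.
have af : pr a <=: cont f by apply/pr_min/cont_in.
have f1f : cont f1 <=: cont f by rewrite ef; apply: smod_addl.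
have bg : pr b <=: cont g by apply/pr_min/cont_in.
have ab : pr a * pr b <=: cont (f * g).
  rewrite -prM; apply: pr_min.
  suff -> : a * b = (f * g)`_(n + k) by apply: cont_in.
  have -> : f = f1 + a *: 'X^n by rewrite subrK.
  rewrite mulrDl coefD -scalerAl coefZ coefXnM ltnNge leq_addr /= addKn.
  rewrite [X in _ = X + _]nth_default ?add0r //.
  apply: leq_trans (size_polyMleq _ _) _; move: hf1 hg.
  case: (size f1) => [|s] h1 h2.
    rewrite add0n; case: (size g) h2 => //= m /ltnSE/leq_trans-> //; exact: leq_addl.
  by rewrite addSn (leq_trans (leq_add (leqnn s) h2)) // addnS -addSn leq_add2r.
have abW : pr a * pr b * cont f ^+ k <=: W.
  by rewrite mulrC; apply: smod_mulS.
have fg1 : cont (f * g1) <=: cont (f * g) + pr b * cont f.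
  by rewrite mulrC [f * g]mulrC; apply: contM_truncate.
have f1g : cont (f1 * g) <=: cont (f * g) + pr a * cont g.
  exact: contM_truncate.
have hI : cont f ^+ k * cont g1 <=: cont f ^+ k.-1 * (cont (f * g) + pr b * cont f).
  by apply: smod_sub_trans (IHk _ _ hf hg1) _; apply: smod_mulS.
have hk (M : smod hR) : M <=: cont f ->
    M * (cont f ^+ k * cont g1) <=: W + pr b * (M * cont f ^+ k).
  (* For [k = 0] the exponent [k.-1] in [hI] is truncated and [cont f] cannot be split off the
     power; but then [g1] is zero. *)
  move=> hM; case: (posnP k) => [k0|k0].
    move: hg1; rewrite k0 leqn0 size_poly_eq0 => /eqP->.
    by rewrite [cont 0]/cont size_poly0 big_nil !mulr0; apply: smod_sub0.
  apply: smod_sub_trans (smod_mulS (@smod_sub_refl M) hI) _.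
  have ek : cont f ^+ k = cont f * cont f ^+ k.-1 by rewrite -exprS prednK.
  rewrite 2!mulrDr; apply: smod_addS.
    by rewrite mulrA /W ek; apply: smod_mulS => //; apply: smod_mulS.
  by rewrite ek [cont f * _]mulrC [X in M * X]mulrCA [X in X <=: _]mulrCA.
have hI' : pr a * (cont f ^+ k * cont g) <=: W.
  rewrite eg mulrDr mulrDr; apply: smod_add_min; last first.
    by rewrite [_ * pr b]mulrC mulrA.
  apply: smod_sub_trans (hk _ af) _; apply: smod_add_min => //.
  by rewrite mulrA [pr b * _]mulrC.
(* Powers of [cont f] with a factor [a] are absorbed by [a b], a coefficient of [f * g]. The
   remaining [cont f1 ^+ k.+1] meets [b] inside [cont g], so the outer induction applies to [f1] and
   [g], with an error bounded by [hI']. *)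
have hII : pr b * cont f ^+ k.+1 <=: W.
  rewrite [in X in X <=: _]ef.
  apply: smod_sub_trans (smod_mulS (@smod_sub_refl _) (@smod_exp_add _ _ _)) _.
  rewrite -ef mulrDr; apply: smod_add_min; last by rewrite mulrA [pr b * _]mulrC.
  rewrite mulrC; apply: smod_sub_trans (smod_mulS (@smod_sub_refl _) bg) _.
  apply: smod_sub_trans (IHn _ _ _ hf1 hg) _; rewrite -pred_Sn.
  apply: smod_sub_trans (smod_mulS (@smod_expS _ _ k f1f) f1g) _.
  by rewrite mulrDr; apply: smod_add_min => //; rewrite mulrCA.
rewrite eg mulrDr; apply: smod_add_min; last by rewrite mulrC.
rewrite exprS -mulrA; apply: smod_sub_trans (hk _ _) _ => //.
by apply: smod_add_min => //; rewrite -exprS.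
Qed.
End Principal.

(** * Finitely generated torsion-free groups *)

Lemma clear_denominators m n (M : 'M[rat]_(m, n)) :
  exists (N : int) (M' : 'M[int]_(m, n)), N != 0 /\ N%:~R *: M = map_mx intr M'.
Proof.
pose N : int := \prod_(p : 'I_m * 'I_n) denq (M p.1 p.2).
exists N, (\matrix_(i, j) numq (N%:~R * M i j)); split.
  by apply/prodf_neq0 => p _; apply: denq_neq0.
apply/matrixP => i j; rewrite !mxE numqK // /N (bigD1 (i, j)) //= intrM mulrAC.
rewrite [_ * M i j]mulrC -[X in X * _%:~R * _]divq_num_den divfK ?rpredM ?intr_int //.
by rewrite intr_eq0 denq_neq0.
Qed.

Lemma map_intr_mx_inj m n : injective (map_mx intr : 'M[int]_(m, n) -> 'M[rat]_(m, n)).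
Proof.
move=> A B /matrixP h; apply/matrixP => i j; have := h i j.
by rewrite !mxE => /intr_inj.
Qed.

Section Embedding.
Variables (G : zmodType).
Hypothesis torsion_free : forall (n : nat) (x : G), (0 < n)%N -> x *+ n = 0 -> x = 0.

Lemma torsion_free_int (z : int) (x : G) : z != 0 -> x *~ z = 0 -> x = 0.
Proof.
move=> z0 h; apply: (@torsion_free `|z|%N); first by rewrite absz_gt0.
rewrite pmulrn abszEsign; case: (z < 0); rewrite ?expr1 ?expr0 ?mul1r //.
by rewrite mulN1r mulrNz h oppr0.
Qed.

Section Relations.
Variable S : seq G.
Let k := size S.

Definition evalZ (v : 'rV[int]_k) : G := \sum_(i < k) S`_i *~ v 0 i.

Lemma evalZB u v : evalZ (u - v) = evalZ u - evalZ v.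
Proof. by rewrite -sumrB; apply: eq_bigr => i _; rewrite !mxE mulrzBr. Qed.
Lemma evalZZ z v : evalZ (z *: v) = evalZ v *~ z.
Proof.
rewrite mulrz_suml; apply: eq_bigr => i _; rewrite !mxE mulrC.
by rewrite mulrzA.
Qed.
Lemma evalZ_mul m (w : 'rV[int]_m) (B : 'M[int]_(m, k)) :
  (forall i, evalZ (row i B) = 0) -> evalZ (w *m B) = 0.
Proof.
move=> h; rewrite /evalZ.
under eq_bigr do rewrite mxE mulrz_sumr.
rewrite exchange_big big1 // => j _ /=.
rewrite -[RHS](mul0rz _ (w 0 j)) -[in RHS](h j) mulrz_suml.
by apply: eq_bigr => i _; rewrite mxE mulrC mulrzA.
Qed.

Definition relation_rank r := exists m (B : 'M[int]_(m, k)),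
  (forall i, evalZ (row i B) = 0) /\ \rank (map_mx intr B : 'M[rat]_(m, k)) = r.

(** Since G is torsion-free, the relations among [S] form a saturated sublattice of Z^k: they are
    the integer points of a rational subspace, which is the kernel of a matrix. So [v -> v M] embeds
    the subgroup generated by [S] in Z^k, with no need for a basis of it. *)
Lemma relation_kernel : exists M : 'M[int]_k, forall v, evalZ v = 0 <-> v *m M = 0.
Proof.
have ex : exists r, `[< relation_rank r >].
  exists 0%N; apply/asboolP; exists 0%N, 0; split=> [[]//|].
  by rewrite map_mx0 mxrank0.
have ub r : `[< relation_rank r >] -> (r <= k)%N.
  by move=> /asboolP[m [B [_ <-]]]; apply: rank_leq_col.
case: (ex_maxnP ex ub) => r /asboolP[m [B [hB rB]]] rmax.
set Bq := map_mx intr B in rB.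
pose toQ (v : 'rV[int]_k) : 'rV[rat]_k := map_mx intr v.
(* A relation outside the row space of [B] would raise the maximal rank. Conversely, clearing
   denominators in a rational combination of relations gives a relation for [N *: v], and [N] is
   cancelled by torsion-freeness. *)
have relP v : evalZ v = 0 <-> (toQ v <= Bq)%MS.
  split=> [hv|/submxP[D hD]].
    pose B' := col_mx B v.
    have le : (Bq <= map_mx intr B')%MS by rewrite map_col_mx -addsmxE addsmxSl.
    have := mxrank_leqif_sup le; rewrite rB => -[_].
    suff -> : r == \rank (map_mx intr B' : 'M[rat]_(m + 1, k)).
      by move/esym; apply: submx_trans; rewrite map_col_mx -addsmxE addsmxSr.
    rewrite eqn_leq -{1}rB mxrankS //=; apply/rmax/asboolP.
    exists (m + 1)%N, B'; split=> // i; rewrite /B'.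
    case: (split_ordP i) => j ->; first by rewrite rowKu.
    by rewrite rowKd [j]ord1 row_id.
  have [N [D' [N0 hD']]] := clear_denominators D.
  apply: (torsion_free_int N0); rewrite -evalZZ.
  suff -> : N *: v = D' *m B by apply: evalZ_mul.
  apply: map_intr_mx_inj.
  by rewrite map_mxM -hD' -scalemxAl -hD map_mxZ.
have [N [M [N0 hM]]] := clear_denominators (cokermx Bq).
exists M => v; rewrite relP submxE.
have -> : (toQ v *m cokermx Bq == 0) = (v *m M == 0).
  rewrite -(inj_eq (@map_intr_mx_inj _ _)) map_mx0 map_mxM -hM -scalemxAr.
  by rewrite scaler_eq0 intr_eq0 (negPf N0).
by split=> [/eqP|->].
Qed.
End Relations.

(** An injective homomorphism into Z^k of a subgroup [G0] containing [S]. Vectors are coded as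
    integer polynomials, so that reading the coordinates as digits is evaluation at the radix.
    Outside [G0] only the size of [pi] is controlled. *)
Record embedding (S : seq G) (G0 : G -> Prop) (pi : G -> {poly int}) (k : nat) : Prop :=
  Embedding {
  emb_gen : forall x, x \in S -> G0 x;
  emb0 : G0 0;
  embB : forall x y, G0 x -> G0 y -> G0 (x - y);
  emb_piB : forall x y, G0 x -> G0 y -> pi (x - y) = pi x - pi y;
  emb_inj : forall x, G0 x -> pi x = 0 -> x = 0;
  emb_size : forall x, (size (pi x) <= k)%N }.

Lemma finite_embedding (S : seq G) : exists G0 pi k, embedding S G0 pi k.
Proof.
have [M hM] := relation_kernel S.
pose G0 x := exists v : 'rV_(size S), evalZ v = x.
have /choice[c hc] : forall x, exists v : 'rV[int]_(size S), G0 x -> evalZ v = x.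
  by move=> x; case: (pselect (G0 x)) => [[v hv]|h]; [exists v | exists 0].
have G0B x y : G0 x -> G0 y -> G0 (x - y).
  by move=> [u <-] [v <-]; exists (u - v); rewrite evalZB.
exists G0, (fun x => rVpoly (c x *m M)), (size S); split=> //.
- move=> x xS; have hx : (index x S < size S)%N by rewrite index_mem.
  exists (delta_mx 0 (Ordinal hx)); rewrite /evalZ (bigD1 (Ordinal hx)) //= big1.
    by rewrite addr0 mxE !eqxx nth_index.
  by move=> i hi; rewrite mxE (negPf hi) andbF mulr0z.
- by exists 0; rewrite /evalZ big1 // => i _; rewrite mxE mulr0z.
- move=> x y hx hy; rewrite -raddfB -mulmxBl; congr rVpoly.
  apply/eqP; rewrite -subr_eq0 -mulmxBl; apply/eqP/hM.
  by rewrite !evalZB !hc ?subrr //; apply: G0B.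
- move=> x hx /(congr1 (poly_rV (d := size S))); rewrite rVpolyK raddf0.
  by move/hM; rewrite hc.
- by move=> x; apply: size_poly.
Qed.
End Embedding.

(** Zero has a unique expansion in signed digits below [D]: the lowest digit is divisible by [D] and
    smaller, hence zero, and dividing by [D] shifts the expansion. The digit bound itself excludes
    [D = 0]. *)
Lemma horner_radix_inj (D : nat) (p : {poly int}) :
  (forall j, `|p`_j| < D%:Z) -> p.[D%:Z] = 0 -> p = 0.
Proof.
elim/poly_ind: p => // p c IH hc.
rewrite hornerMXaddC => h.
have c0 : c = 0.
  have /dvdzP : (D%:Z %| c)%Z.
    by apply/dvdzP; exists (- p.[D%:Z]); rewrite mulNr; apply/eqP; rewrite -addr_eq0 addrC h.
  case=> q cE; have := hc 0%N; rewrite coefD coefMX coefC /= add0r cE.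
  rewrite normrM; case: (eqVneq q 0) => [-> | q0]; first by rewrite mul0r.
  rewrite (ger0_norm (x := D%:Z)) // => hq; exfalso.
  move: hq; apply/negP; rewrite -leNgt ler_peMl //.
  by rewrite -gtz0_ge1 normr_gt0.
rewrite c0 addr0 in h; rewrite c0 polyC0 addr0; suff -> : p = 0 by rewrite mul0r.
apply: IH => [j|].
  by have := hc j.+1; rewrite coefD coefMX coefC /= addr0.
move/eqP: h; rewrite mulf_eq0 => /orP[/eqP //|/eqP D0].
by have := hc 0%N; rewrite D0 normr_lt0.
Qed.

Lemma seq_bound (T : eqType) (f : T -> int) (s : seq T) :
  exists B : nat, forall x, x \in s -> `|f x| <= B%:Z.
Proof.
elim: s => [|a s [B hB]]; first by exists 0%N.
exists (`|f a| + B)%N => x; rewrite inE PoszD abszE => /predU1P[->|/hB h].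
  by rewrite lerDl.
by apply: le_trans h _; rewrite lerDr.
Qed.

Lemma coef_bound (T : eqType) (f : T -> {poly int}) (s : seq T) :
  exists B : nat, forall x, x \in s -> forall j, `|(f x)`_j| <= B%:Z.
Proof.
pose n := \max_(x <- s) size (f x).
have [B hB] := seq_bound (fun p : T * nat => (f p.1)`_p.2) [seq (x, j) | x <- s, j <- iota 0 n].
exists B => x xs j; have [jn|jn] := ltnP j (size (f x)).
  apply: (hB (x, j)); apply/allpairsP; exists (x, j); split=> //=.
  rewrite mem_iota /= add0n; apply: leq_trans jn _.
  exact: (leq_bigmax_seq (F := fun x => size (f x))).
by rewrite nth_default // normr0.
Qed.

(** A Freiman isomorphism of order two from [S] into the natural numbers: embed in Z^k, read the
    coordinates as digits, and translate. *)
Lemma freiman_nat (G : zmodType) (S : seq G) :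
  (forall (n : nat) (x : G), (0 < n)%N -> x *+ n = 0 -> x = 0) ->
  exists psi : G -> nat, forall p q p' q', p \in S -> q \in S -> p' \in S -> q' \in S ->
    p + q = p' + q' <-> (psi p + psi q = psi p' + psi q')%N.
Proof.
move=> tf; have [G0 [pi [k E]]] := finite_embedding tf S.
have [B hB] := coef_bound pi S.
(* The coordinates of [p + q - p' - q'] are at most [4 * B] in absolute value. *)
pose D := (4 * B).+1; pose psi x := (pi x).[D%:Z].
have [N hN] := seq_bound psi S.
(* Adding [N] makes the values nonnegative and cancels in the comparison, both sides having two
   summands. *)
exists (fun x => `|(psi x + N%:Z)%R|%N) => p q p' q' pS qS p'S q'S.
have hpos x : x \in S -> (`|(psi x + N%:Z)%R|%N)%:Z = psi x + N%:Z.
  move=> /hN; rewrite ler_norml => /andP[h _].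
  by rewrite abszE ger0_norm // -lerBlDr sub0r.
have hG x : x \in S -> G0 x := @emb_gen _ _ _ _ _ E x.
have G0N x : G0 x -> G0 (- x) by move=> hx; rewrite -sub0r; apply: (embB E) => //; apply: (emb0 E).
have pi0 : pi 0 = 0 by rewrite -[X in pi X](subrr 0) (emb_piB E) ?subrr //; apply: (emb0 E).
have piN x : G0 x -> pi (- x) = - pi x.
  by move=> hx; rewrite -sub0r (emb_piB E) ?pi0 ?sub0r //; apply: (emb0 E).
have e : pi (p + q - p' - q') = pi p + pi q - pi p' - pi q'.
  have G0D : G0 (p + q) by rewrite -[q]opprK; apply: (embB E); auto.
  have G0B : G0 (p + q - p') by apply: (embB E); auto.
  have [Gq Gq' Gp Gp'] : [/\ G0 q, G0 q', G0 p & G0 p'] by split; auto.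
  rewrite (emb_piB E) // (emb_piB E) //; congr (_ - _ - _).
  rewrite -[q in LHS]opprK (emb_piB E) ?piN ?opprK //; exact: G0N.
have -> : (`|(psi p + N%:Z)%R| + `|(psi q + N%:Z)%R|
    = `|(psi p' + N%:Z)%R| + `|(psi q' + N%:Z)%R|)%N <-> psi p + psi q - psi p' - psi q' = 0.
  split=> [/(congr1 Posz)|h].
    rewrite !PoszD !hpos // => h; apply/eqP; rewrite -addrA -opprD subr_eq0.
    by move/eqP: h; rewrite addrACA [X in _ == X]addrACA (inj_eq (addIr _)).
  apply/eqP; rewrite -eqz_nat !PoszD !hpos // addrACA [X in _ == X]addrACA (inj_eq (addIr _)).
  by rewrite -subr_eq0 opprD addrA h.
have -> : psi p + psi q - psi p' - psi q' = (pi (p + q - p' - q')).[D%:Z].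
  by rewrite e !hornerE.
split=> [h|h].
  by rewrite h (addrC p') addrK subrr pi0 horner0.
apply/eqP; rewrite -subr_eq0 opprD addrA; apply/eqP/(emb_inj E).
  do 2![apply: (embB E); auto]; rewrite -[q]opprK; apply: (embB E); auto.
apply: (horner_radix_inj _ h) => j; rewrite e !(coefB, coefD).
have hb x : x \in S -> `|(pi x)`_j| <= B%:Z by move=> xS; apply: hB.
apply: le_lt_trans (_ : _ <= B%:Z *+ 4) _; last first.
  suff -> : D%:Z = B%:Z *+ 4 + 1 by rewrite ltrDl.
  by rewrite /D -[(4 * B).+1]addn1 PoszD PoszM -[4%:Z]natz mulr_natl.
rewrite !mulrS mulr0n addr0 !addrA.
apply: le_trans (ler_normB _ _) _; apply: lerD; last by auto.
apply: le_trans (ler_normB _ _) _; apply: lerD; last by auto.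
by apply: le_trans (ler_normD _ _) _; apply: lerD; auto.
Qed.

(** * Graded components in the homogeneous quotient field *)

Lemma filter_key (T U : eqType) (d : seq (T * U)) p :
  uniq (map fst d) -> p \in d -> [seq q <- d | q.1 == p.1] = [:: p].
Proof.
elim: d => //= q e IH /andP[qe ue]; rewrite inE => /predU1P[ep|pe].
  rewrite -ep eqxx; congr cons; apply/eqP; rewrite -(negbK (_ == _)) -has_filter.
  by apply/hasP => -[r re /eqP h]; case/negP: qe; rewrite -ep -h map_f.
rewrite ifN ?IH //; apply: contraNneq qe => ->; exact: map_f.
Qed.

Section Grading.
Variables (K : fieldType) (G : zmodType).
Variables (Gam : G -> Prop) (R : K -> Prop) (Rc : G -> K -> Prop).
Hypothesis gd : graded_domain Gam R Rc.
Implicit Types (x y z : K) (a b g : G) (e : seq (G * K)) (P : pred G).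

Lemma gd_torsion_free (n : nat) g : (0 < n)%N -> g *+ n = 0 -> g = 0.
Proof. by case: gd => -[h _ _ _ _] _; apply: h. Qed.
Lemma gd_subring : subring R. Proof. by case: gd => -[]. Qed.
Lemma gd_frac x : exists y z, [/\ R y, R z, z != 0 & x = y / z].
Proof. by case: gd => -[_ _ _ h _] _; apply: h. Qed.
Lemma Rc0 a : Rc a 0. Proof. by case: gd => -[_ _ _ _ /(_ a)[]]. Qed.
Lemma RcB a x y : Rc a x -> Rc a y -> Rc a (x - y).
Proof. by case: gd => -[_ _ _ _ /(_ a)[_ h _ _]] _; apply: h. Qed.
Lemma RcN a x : Rc a x -> Rc a (- x). Proof. by rewrite -sub0r; apply: RcB (Rc0 a). Qed.
Lemma RcD a x y : Rc a x -> Rc a y -> Rc a (x + y).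
Proof. by move=> hx /RcN; rewrite -{2}[y]opprK; apply: RcB. Qed.
Lemma Rc_sub a x : Rc a x -> R x. Proof. by case: gd => -[_ _ _ _ /(_ a)[_ _ h _]] _; apply: h. Qed.
Lemma Rc_Gam a x : Rc a x -> x != 0 -> Gam a.
Proof.
case: gd => -[_ _ _ _ /(_ a)[_ _ _ h]] _ hx x0.
by apply: contrapT => /h /(_ x hx) /eqP; apply/negP.
Qed.
Lemma RcM a b x y : Rc a x -> Rc b y -> Rc (a + b) (x * y).
Proof. by case: gd => _ [h _ _]; apply: h. Qed.
Lemma R_decomp x : R x -> exists d, hdecomp Gam Rc x d.
Proof. by case: gd => _ [_ h _]; apply: h. Qed.
Lemma hdecomp0 d p : hdecomp Gam Rc 0 d -> p \in d -> p.2 = 0.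
Proof. by case: gd => _ [_ _ h] hd; apply: h. Qed.

Lemma homogeneous_exists : exists b s, s != 0 /\ Rc b s.
Proof.
have [d [_ hd e1]] := R_decomp (subring1 gd_subring).
apply: contrapT => h; have /eqP := oner_neq0 K; case.
rewrite e1 big_seq big1 // => p /hd[_ hp]; apply/eqP/negPn/negP => p0.
by case: h; exists p.1, p.2.
Qed.

(* [hfrac g x]: [x] is an element of degree [g] of the homogeneous quotient
   field [R_H], zero having every degree *)
Definition hfrac g x := exists b s, [/\ s != 0, Rc b s & Rc (g + b) (x * s)].

Lemma hfrac0 g : hfrac g 0.
Proof.
by have [b [s [s0 hs]]] := homogeneous_exists; exists b, s; rewrite mul0r; split=> //; apply: Rc0.
Qed.
Lemma Rc_hfrac g x : Rc g x -> hfrac g x.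
Proof.
by have [b [s [s0 hs]]] := homogeneous_exists; exists b, s; split=> //; apply: RcM.
Qed.
Lemma hfrac1 : hfrac 0 1.
Proof. by have [b [s [s0 hs]]] := homogeneous_exists; exists b, s; rewrite add0r mul1r. Qed.
Lemma hfracN g x : hfrac g x -> hfrac g (- x).
Proof. by case=> b [s [s0 hs hx]]; exists b, s; rewrite mulNr; split=> //; apply: RcN. Qed.
Lemma hfracD g x y : hfrac g x -> hfrac g y -> hfrac g (x + y).
Proof.
move=> [b [s [s0 hs hx]]] [c [t [t0 ht hy]]]; exists (b + c), (s * t).
split; [by rewrite mulf_neq0 | exact: RcM | rewrite mulrDl; apply: RcD].
  by rewrite mulrA addrA; apply: RcM.
by rewrite mulrCA addrCA; apply: RcM.
Qed.
Lemma hfracM g h x y : hfrac g x -> hfrac h y -> hfrac (g + h) (x * y).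
Proof.
move=> [b [s [s0 hs hx]]] [c [t [t0 ht hy]]]; exists (b + c), (s * t).
by split; [rewrite mulf_neq0 | exact: RcM | rewrite mulrACA addrACA; apply: RcM].
Qed.
Lemma hfracV g x : hfrac g x -> hfrac (- g) x^-1.
Proof.
case: (eqVneq x 0) => [-> _|x0]; first by rewrite invr0; apply: hfrac0.
move=> [b [s [s0 hs hx]]]; exists (g + b), (x * s).
by rewrite mulf_neq0 // mulKf // addKr; split.
Qed.
Lemma hfrac_sum g (I : eqType) (r : seq I) (P : pred I) (F : I -> K) :
  (forall i, i \in r -> P i -> hfrac g (F i)) -> hfrac g (\sum_(i <- r | P i) F i).
Proof.
move=> h; rewrite big_seq_cond; apply: big_ind => [||i /andP[]].
- exact: hfrac0.
- exact: hfracD.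
- exact: h.
Qed.

Definition terms e := forall p, p \in e -> hfrac p.1 p.2.

Lemma terms_cat e e' : terms e -> terms e' -> terms (e ++ e').
Proof. by move=> h h' p; rewrite mem_cat => /orP[/h|/h']. Qed.

Lemma common_denominator e : terms e ->
  exists b s, [/\ s != 0, Rc b s & forall p, p \in e -> Rc (p.1 + b) (p.2 * s)].
Proof.
elim: e => [_|q e IH he].
  by have [b [s [s0 hs]]] := homogeneous_exists; exists b, s; split.
have [|b [s [s0 hs hp]]] := IH; first by move=> p pe; apply: he; rewrite inE pe orbT.
have [|c [t [t0 ht hq]]] := he q; first exact: mem_head.
exists (b + c), (s * t); split; [by rewrite mulf_neq0 | exact: RcM | move=> p].
rewrite inE => /predU1P[->|/hp h]; first by rewrite mulrCA addrCA; apply: RcM.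
by rewrite mulrA addrA; apply: RcM.
Qed.

(** The predicate is arbitrary because three kinds of projection are needed: onto one degree, onto
    the degrees in a subgroup, and onto a level set of a linear functional. *)
Definition part P e := \sum_(p <- e | P p.1) p.2.

Lemma part_keys P e :
  part P e = \sum_(a <- undup (map fst e) | P a) part (pred1 a) e.
Proof.
rewrite /part [RHS](eq_bigr (fun a => \sum_(p <- e) if p.1 == a then p.2 else 0)); last first.
  by move=> a _; rewrite big_mkcond.
rewrite exchange_big /= big_mkcond big_seq [RHS]big_seq.
apply: eq_bigr => p pe; rewrite big_mkcond (bigD1_seq p.1) ?undup_uniq //=.
  by rewrite eqxx big1 ?addr0 // => a /negPf; rewrite eq_sym => ->; case: ifP.
by rewrite mem_undup map_f.
Qed.

(** The grading of the homogeneous quotient field is direct: a common homogeneous denominator moves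
    a vanishing sum into [R], where [hdecomp0] applies. *)
Lemma part_eq0 e : terms e -> \sum_(p <- e) p.2 = 0 -> forall P, part P e = 0.
Proof.
move=> he e0 P; rewrite part_keys big1_seq // => a /andP[_ ha].
have [b [s [s0 hs hp]]] := common_denominator he.
pose c a := part (pred1 a) e * s.
(* Zero terms are dropped because [hdecomp] asks for degrees in [Gam], and only a nonzero element
   certifies that its degree lies there. *)
pose d := [seq (a + b, c a) | a <- undup (map fst e) & c a != 0].
have cR a' : Rc (a' + b) (c a').
  rewrite /c /part mulr_suml big_seq_cond; apply: big_ind => [||p /andP[pe /eqP<-]].
  - exact: Rc0.
  - exact: RcD.
  - exact: hp.
have hd : hdecomp Gam Rc 0 d.
  split.
  - rewrite -map_comp map_inj_uniq; last by move=> ? ? /addIr.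
    by rewrite filter_uniq ?undup_uniq.
  - move=> p /mapP[a' ]; rewrite mem_filter => /andP[h0 _] -> /=.
    by split=> //; apply: Rc_Gam (cR a') h0.
  rewrite big_map big_filter /= big_rmcond => [|a' /negPn/eqP //].
  by rewrite -mulr_suml -(part_keys predT) /part e0 mul0r.
apply/eqP/negPn/negP => a0; have ca : c a != 0 by rewrite mulf_neq0.
have /(hdecomp0 hd) /= /eqP : (a + b, c a) \in d by apply: map_f; rewrite mem_filter ca.
by rewrite (negPf ca).
Qed.

Lemma eq_part e e' P : terms e -> terms e' ->
  \sum_(p <- e) p.2 = \sum_(p <- e') p.2 -> part P e = part P e'.
Proof.
move=> he he' ee'; pose n := [seq (p.1, - p.2) | p <- e'].
have := @part_eq0 (e ++ n); rewrite big_cat big_map /= sumrN ee' subrr.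
move=> /(_ _ erefl P) h; apply/eqP; rewrite -subr_eq0; apply/eqP.
rewrite -[RHS]h; first by rewrite /part big_cat big_map /= sumrN.
by apply: terms_cat => // _ /mapP[p /he' hp ->]; apply: hfracN.
Qed.

Lemma terms_filter e (P : pred (G * K)) : terms e -> terms [seq p <- e | P p].
Proof. by move=> h p; rewrite mem_filter => /andP[_ /h]. Qed.

Definition tmul e e' := [seq (p.1 + q.1, p.2 * q.2) | p <- e, q <- e'].

Lemma terms_mul e e' : terms e -> terms e' -> terms (tmul e e').
Proof.
by move=> he he' _ /allpairsP[[p q] [/he hp /he' hq ->]]; apply: hfracM.
Qed.
Lemma part_mul P e e' :
  part P (tmul e e') = \sum_(p <- e) \sum_(q <- e' | P (p.1 + q.1)) p.2 * q.2.
Proof.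
rewrite /part big_mkcond big_allpairs_dep; apply: eq_bigr => p _.
by rewrite [RHS]big_mkcond.
Qed.
Lemma sum_tmul e e' :
  \sum_(p <- tmul e e') p.2 = (\sum_(p <- e) p.2) * (\sum_(p <- e') p.2).
Proof.
by rewrite big_allpairs_dep mulr_suml; apply: eq_bigr => p _; rewrite mulr_sumr.
Qed.

Definition RHs x := exists e, terms e /\ x = \sum_(p <- e) p.2.

Definition good_terms x e := [/\ terms e, x = \sum_(p <- e) p.2, uniq (map fst e)
  & forall p, p \in e -> p.2 != 0].

Lemma good_terms_exists x : RHs x -> exists e, good_terms x e.
Proof.
move=> [e [he ->]]; pose c a := part (pred1 a) e.
exists [seq (a, c a) | a <- undup (map fst e) & c a != 0]; split.
- move=> _ /mapP[a _ ->] /=; rewrite /c /part; apply: hfrac_sum.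
  by move=> p pe /eqP <-; apply: he.
- rewrite big_map big_filter /= [RHS]big_rmcond => [|a' /negPn/eqP //].
  exact: (part_keys predT).
- by rewrite -map_comp map_inj_uniq ?filter_uniq ?undup_uniq.
- by move=> p /mapP[a]; rewrite mem_filter => /andP[? _] ->.
Qed.

(** A chosen reduced expansion; it is empty when [x] is outside the homogeneous quotient field,
    which makes [component] and [keys] total. *)
Definition dec x : seq (G * K) :=
  if pselect (exists e, good_terms x e) is left h then projT1 (cid h) else [::].

Lemma decP x : RHs x -> good_terms x (dec x).
Proof.
move=> /good_terms_exists h; rewrite /dec; case: pselect => // h'.
by case: (cid h').
Qed.
Lemma terms_dec x : RHs x -> terms (dec x). Proof. by case/decP. Qed.
Lemma sum_dec x : RHs x -> \sum_(p <- dec x) p.2 = x. Proof. by case/decP. Qed.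

Definition component x a := part (pred1 a) (dec x).
Definition keys x := map fst (dec x).

Lemma partE e P : terms e -> part P (dec (\sum_(p <- e) p.2)) = part P e.
Proof.
move=> he; have hx : RHs (\sum_(p <- e) p.2) by exists e.
by apply: eq_part => //; [apply: terms_dec | rewrite sum_dec].
Qed.
Lemma compE e a : terms e -> component (\sum_(p <- e) p.2) a = part (pred1 a) e.
Proof. exact: partE. Qed.

Lemma mem_dec x p : RHs x -> p \in dec x -> p.2 = component x p.1 /\ p.2 != 0.
Proof.
move=> /decP[_ _ u nz] px; split; last exact: nz.
rewrite /component /part -big_filter; suff -> : [seq q <- dec x | q.1 == p.1] = [:: p].
  by rewrite big_seq1.
exact: filter_key.
Qed.

Lemma keysP x a : RHs x -> (a \in keys x) = (component x a != 0).
Proof.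
move=> hx; apply/idP/idP => [/mapP[p px ->]|].
  by have [<- ] := mem_dec hx px.
apply: contraNT => ax; rewrite /component /part big_seq_cond big1 // => p /andP[px /eqP pa].
by case/negP: ax; rewrite -pa map_f.
Qed.
Lemma dec_keys x : RHs x -> dec x = [seq (a, component x a) | a <- keys x].
Proof.
move=> hx; rewrite -map_comp -[LHS]map_id; apply/eq_in_map => -[a y] p /=.
by have [/= -> _] := mem_dec hx p.
Qed.
Lemma sum_comp x : RHs x -> x = \sum_(a <- keys x) component x a.
Proof. by move=> hx; rewrite -{1}(sum_dec hx) dec_keys // big_map. Qed.
Lemma keys_uniq x : uniq (keys x).
Proof.
rewrite /keys; case: (pselect (RHs x)) => [/decP[]//|h]; rewrite /dec.
case: pselect => // h'; case: (cid h') => /= e _; case: h.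
by case: h' => e' [he' ex _ _]; exists e'.
Qed.
Lemma keys_neq0 x : RHs x -> x != 0 -> exists a, a \in keys x.
Proof.
move=> hx; rewrite {1}(sum_comp hx); case: (keys x) => [|a s _]; first by rewrite big_nil eqxx.
by exists a; rewrite mem_head.
Qed.

Lemma hfrac_comp x a : RHs x -> hfrac a (component x a).
Proof.
move=> /terms_dec hx; apply: hfrac_sum => p px /eqP <-; exact: hx.
Qed.
Lemma hfrac_RHs g x : hfrac g x -> RHs x.
Proof.
move=> hx; exists [:: (g, x)]; rewrite big_seq1; split=> //.
by move=> p; rewrite inE => /eqP->.
Qed.
Lemma comp_hfrac g x a : hfrac g x -> component x a = if a == g then x else 0.
Proof.
move=> hx; have ex : x = \sum_(p <- [:: (g, x)]) p.2 by rewrite big_seq1.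
rewrite {1}ex compE; last by move=> p; rewrite inE => /eqP->.
by rewrite /part big_mkcond big_seq1 /= eq_sym.
Qed.
Lemma RHs0 : RHs 0. Proof. exact: hfrac_RHs (hfrac0 0). Qed.
Lemma RHs1 : RHs 1. Proof. exact: hfrac_RHs hfrac1. Qed.
Lemma RHsD x y : RHs x -> RHs y -> RHs (x + y).
Proof.
move=> [e [he ->]] [e' [he' ->]]; exists (e ++ e'); rewrite big_cat; split=> //.
exact: terms_cat.
Qed.
Lemma RHsM x y : RHs x -> RHs y -> RHs (x * y).
Proof.
move=> [e [he ->]] [e' [he' ->]]; exists (tmul e e'); rewrite sum_tmul.
by split=> //; apply: terms_mul.
Qed.
Lemma RHsN x : RHs x -> RHs (- x).
Proof.
by rewrite -mulN1r; apply: RHsM; rewrite -[1]opprK opprK; apply: hfrac_RHs (hfracN hfrac1).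
Qed.
Lemma RHsB x y : RHs x -> RHs y -> RHs (x - y).
Proof. by move=> hx /RHsN; apply: RHsD. Qed.
Lemma RHsX x n : RHs x -> RHs (x ^+ n).
Proof. by move=> hx; elim: n => [|n IH]; [exact: RHs1 | rewrite exprS; apply: RHsM]. Qed.
Lemma RHs_sum (I : eqType) (r : seq I) (P : pred I) (F : I -> K) :
  (forall i, i \in r -> P i -> RHs (F i)) -> RHs (\sum_(i <- r | P i) F i).
Proof.
move=> h; rewrite big_seq_cond; apply: big_ind => [||i /andP[]].
- exact: RHs0.
- exact: RHsD.
- exact: h.
Qed.

Lemma compD x y a : RHs x -> RHs y -> component (x + y) a = component x a + component y a.
Proof.
move=> hx hy; rewrite -{1}(sum_dec hx) -{1}(sum_dec hy) -big_cat compE.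
  by rewrite /part big_cat.
by apply: terms_cat; apply: terms_dec.
Qed.
Lemma comp0 a : component 0 a = 0.
Proof. by rewrite (comp_hfrac _ (hfrac0 a)) if_same. Qed.
Lemma compB x y a : RHs x -> RHs y -> component (x - y) a = component x a - component y a.
Proof.
by move=> hx hy; have := compD a (RHsB hx hy) hy; rewrite subrK => ->; rewrite addrK.
Qed.
Lemma comp_sum (I : eqType) (r : seq I) (F : I -> K) a :
  (forall i, i \in r -> RHs (F i)) ->
  component (\sum_(i <- r) F i) a = \sum_(i <- r) component (F i) a.
Proof.
elim: r => [|i r IH] h; first by rewrite !big_nil comp0.
have h' j : j \in r -> RHs (F j) by move=> jr; apply: h; rewrite inE jr orbT.
rewrite !big_cons compD ?IH //; first by apply: h; rewrite mem_head.
by apply: RHs_sum => j jr _; apply: h'.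
Qed.
Lemma partM P x y : RHs x -> RHs y ->
  part P (dec (x * y)) = \sum_(p <- dec x) \sum_(q <- dec y | P (p.1 + q.1)) p.2 * q.2.
Proof.
move=> hx hy; rewrite -{1}(sum_dec hx) -{1}(sum_dec hy) -sum_tmul partE ?part_mul //.
by apply: terms_mul; apply: terms_dec.
Qed.
Lemma comp_mul_hfrac g u x a : hfrac g u -> RHs x -> component (x * u) (a + g) = component x a * u.
Proof.
move=> hu hx; pose e := [:: (g, u)].
have he : terms e by move=> p; rewrite inE => /eqP->.
have eu : u = \sum_(p <- e) p.2 by rewrite big_seq1.
rewrite {1}eu -{1}(sum_dec hx) -sum_tmul compE; last by apply: terms_mul => //; apply: terms_dec.
rewrite part_mul /component /part mulr_suml [RHS]big_mkcond; apply: eq_bigr => p _.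
by rewrite big_mkcond big_seq1 /= (inj_eq (addIr g)); case: eqP.
Qed.
Lemma keysM x y a : RHs x -> RHs y -> a \in keys (x * y) ->
  exists b c, [/\ b \in keys x, c \in keys y & a = b + c].
Proof.
move=> hx hy; rewrite keysP; last exact: RHsM.
move=> ha; apply: contrapT => h; case/eqP: ha; rewrite /component partM //.
rewrite big_seq big1 // => p px; rewrite big_seq_cond big1 // => q /andP[qy /eqP e].
by case: h; exists p.1, q.1; rewrite -e !map_f.
Qed.

Lemma R_RHs x : R x -> RHs x.
Proof.
move=> /R_decomp[d [_ hd ->]]; exists d; split=> // p /hd[_]; exact: Rc_hfrac.
Qed.
Lemma hdecomp_comp x d p : hdecomp Gam Rc x d -> p \in d -> component x p.1 = p.2.
Proof.
case=> ud hd -> pd; have td : terms d by move=> q /hd[_]; apply: Rc_hfrac.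
rewrite compE // /part -big_filter.
suff -> : [seq q <- d | q.1 == p.1] = [:: p] by rewrite big_seq1.
exact: filter_key.
Qed.
Lemma Rc_comp x a : R x -> Rc a (component x a).
Proof.
move=> /R_decomp[d hd]; have [ud hd' ex] := hd.
have td : terms d by move=> q /hd'[_]; apply: Rc_hfrac.
rewrite ex compE // /part big_seq_cond; apply: big_ind => [||p /andP[/hd'[_ hp] /eqP <-]//].
  exact: Rc0.
exact: RcD.
Qed.
Lemma R_comp x a : R x -> R (component x a). Proof. by move=> /Rc_comp h; apply: Rc_sub (h a). Qed.

Lemma Rc1 : Rc 0 1.
Proof.
have h := Rc_comp 0 (subring1 gd_subring).
by rewrite (comp_hfrac _ hfrac1) eqxx in h.
Qed.
Lemma homog1 : homog Gam Rc 1.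
Proof.
split; first exact: oner_neq0.
by exists 0; split; [apply: Rc_Gam Rc1 (oner_neq0 K) | exact: Rc1].
Qed.
Lemma homogE s : homog Gam Rc s <-> s != 0 /\ exists b, Rc b s.
Proof.
split=> [[s0 [b [_ hs]]]|[s0 [b hs]]]; first by split=> //; exists b.
by split=> //; exists b; split=> //; apply: Rc_Gam hs s0.
Qed.

Lemma RH_RHs x : RH Gam R Rc x <-> RHs x.
Proof.
split=> [[y [s [/R_RHs hy [/homogE[s0 [b hs]] ->]]]]|[e [he ->]]].
  by apply: RHsM => //; apply: hfrac_RHs (hfracV (Rc_hfrac hs)).
have [b [s [s0 hs hp]]] := common_denominator he.
exists (\sum_(p <- e) p.2 * s), s; split.
  rewrite big_seq; apply: (subring_sum gd_subring) => p /hp; exact: Rc_sub.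
by rewrite -mulr_suml mulfK //; split=> //; apply/homogE; split=> //; exists b.
Qed.
End Grading.

(** * Complete integral closedness of the homogeneous quotient field *)

Section CompletelyIntegrallyClosed.
Variables (K : fieldType) (G : zmodType).
Variables (Gam : G -> Prop) (R : K -> Prop) (Rc : G -> K -> Prop).
Hypothesis gd : graded_domain Gam R Rc.
Local Notation RHs := (RHs Rc).
Local Notation dec := (dec Rc).
Local Notation component := (component Rc).
Local Notation keys := (keys Rc).
Implicit Types (x y : K) (P : pred G).

Lemma comp_part P x g : RHs x -> P g -> component (part P (dec x)) g = component x g.
Proof.
move=> hx Pg; rewrite /part -big_filter (compE gd); last first.
  by apply: terms_filter; apply: (terms_dec gd).
rewrite /component /part big_filter_cond; apply: eq_bigl => p /=.
by case: eqP => [->|_]; rewrite ?Pg ?andbF.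
Qed.

Lemma part_neq0 P x g : RHs x -> g \in keys x -> P g -> part P (dec x) != 0.
Proof.
move=> hx gx Pg; rewrite (keysP gd) // in gx; apply: contraNneq gx => h.
by rewrite -(comp_part hx Pg) h (comp0 gd).
Qed.

Definition is_degree (theta : G -> int) x d :=
  (exists2 g, g \in keys x & theta g = d) /\ forall g, g \in keys x -> theta g <= d.

Lemma degree_exists theta x : RHs x -> x != 0 -> exists d, is_degree theta x d.
Proof.
move=> hx /(keys_neq0 gd hx); rewrite /is_degree; elim: (keys x) => [|g s IH _]; first by case.
case: s IH => [_|h s /(_ _)[|d [[g' gs <-] hd]]].
- by exists (theta g); split=> [|g']; [exists g; rewrite ?mem_head | rewrite inE => /eqP->].
- by exists h; rewrite mem_head.
have [le|lt] := lerP (theta g) (theta g').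
  exists (theta g'); split; first by exists g' => //; rewrite inE gs orbT.
  by move=> g2; rewrite inE => /predU1P[->|/hd].
exists (theta g); split; first by exists g => //; rewrite mem_head.
by move=> g2; rewrite inE => /predU1P[->|/hd h2] //; apply: le_trans h2 (ltW lt).
Qed.

Lemma degree_unique theta x d e : is_degree theta x d -> is_degree theta x e -> d = e.
Proof.
move=> [[g gx <-] hd] [[h hx <-] he]; apply/eqP; rewrite eq_le.
by rewrite he // hd.
Qed.

Section Subgroup.
Variable G0 : G -> Prop.
Hypothesis G00 : G0 0.
Hypothesis G0B : forall g h, G0 g -> G0 h -> G0 (g - h).

Let G0N g : G0 g -> G0 (- g). Proof. by rewrite -sub0r; apply: G0B. Qed.
Let G0D g h : G0 g -> G0 h -> G0 (g + h).
Proof. by move=> hg /G0N hh; rewrite -[h]opprK; apply: G0B. Qed.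

Definition supported x := forall g, g \in keys x -> G0 g.

Lemma supportedM x y : RHs x -> RHs y -> supported x -> supported y -> supported (x * y).
Proof.
by move=> hx hy kx ky g /(keysM gd hx hy)[b [c [/kx hb /ky hc ->]]]; apply: G0D.
Qed.
Lemma supported1 : supported 1.
Proof.
move=> g; rewrite (keysP gd) ?(comp_hfrac gd _ (hfrac1 gd)); last exact: (RHs1 gd).
by case: (g =P 0) => [->|_]; rewrite ?eqxx.
Qed.
Lemma supportedX x n : RHs x -> supported x -> supported (x ^+ n).
Proof.
move=> hx kx; elim: n => [|n IH]; first exact: supported1.
by rewrite exprS; apply: supportedM => //; apply: (RHsX gd).
Qed.

(** Projection onto the degrees in [G0] commutes with multiplication by [v], whose support lies in
    [G0]. Hence [v] times the projection of [y] is [u], and cancelling [v] shows that [y] equals its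
    projection. *)
Lemma supported_quotient u v y : v != 0 -> RHs v -> RHs y -> u = v * y ->
  supported u -> supported v -> supported y.
Proof.
move=> v0 hv hy uE ku kv; pose P g := `[< G0 g >].
have hu : RHs u by rewrite uE; apply: (RHsM gd).
have eu : part P (dec u) = u.
  rewrite -[RHS](sum_dec gd hu) /part big_seq_cond [RHS]big_seq; apply: eq_bigl => p.
  by case pu: (p \in dec u) => //=; apply/asboolP/ku; rewrite map_f.
have ey : y = part P (dec y).
  apply: (mulfI v0); rewrite -uE -{1}eu uE (partM gd) //.
  rewrite -{2}(sum_dec gd hv) mulr_suml big_seq [RHS]big_seq; apply: eq_bigr => p pv.
  rewrite mulr_sumr; apply: eq_bigl => q; have hp : G0 p.1 by apply: kv; rewrite map_f.
  apply/asboolP/asboolP => [h|]; last exact: G0D.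
  by rewrite -[q.1](addKr p.1) addrC; apply: G0B.
move=> g; rewrite (keysP gd) // ey /part -big_filter (compE gd); last first.
  by apply: terms_filter; apply: (terms_dec gd).
rewrite /part big_filter_cond => h0; apply: contrapT => h; case/eqP: h0.
by rewrite big1 // => p /andP[/asboolP Pp /eqP pg]; case: h; rewrite -pg.
Qed.

Definition additive_on (theta : G -> int) :=
  forall g h, G0 g -> G0 h -> theta (g + h) = theta g + theta h.

(** [theta] need not be injective, so leading parts may have several terms. The part of [x * y] at
    level [d + e] is the product of the two leading parts, nonzero because [K] is a field. *)
Lemma degreeM theta x y d e : additive_on theta -> RHs x -> RHs y ->
  supported x -> supported y ->
  is_degree theta x d -> is_degree theta y e -> is_degree theta (x * y) (d + e).
Proof.
move=> th hx hy kx ky [[g gx gd'] hd] [[h hhy he'] he]; split; last first.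
  move=> k /(keysM gd hx hy)[b [c [hb hc ->]]]; rewrite th; auto.
  by apply: lerD; auto.
apply: contrapT => no.
have : part (fun g => theta g == d + e) (dec (x * y)) = 0.
  rewrite /part big_seq_cond big1 // => p /andP[pxy /eqP hp].
  by case: no; exists p.1 => //; rewrite map_f.
rewrite (partM gd) // => /eqP; apply/negP.
have -> : \sum_(p <- dec x) \sum_(q <- dec y | theta (p.1 + q.1) == d + e) p.2 * q.2
    = part (fun g => theta g == d) (dec x) * part (fun g => theta g == e) (dec y).
  rewrite mulr_suml [RHS]big_mkcond big_seq [RHS]big_seq; apply: eq_bigr => p px.
  have pk : p.1 \in keys x by rewrite map_f.
  case: eqP => hp.
    rewrite mulr_sumr big_seq_cond [RHS]big_seq_cond; apply: eq_bigl => q.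
    case qy: (q \in dec y) => //=; have qk : q.1 \in keys y by rewrite map_f.
    by rewrite th ?hp ?(inj_eq (addrI d)); auto.
  rewrite big_seq_cond big1 // => q /andP[qy]; have qk : q.1 \in keys y by rewrite map_f.
  rewrite th; auto; move=> /eqP hpq; exfalso.
  suff : theta p.1 + theta q.1 < d + e by rewrite hpq ltxx.
  by rewrite ltr_leD ?he // lt_neqAle hd // andbT; apply/eqP.
apply: mulf_neq0; first by apply: part_neq0 gx _; rewrite // gd'.
by apply: part_neq0 hhy _; rewrite // he'.
Qed.

Lemma degreeX theta x d n : additive_on theta -> RHs x -> supported x ->
  is_degree theta x d -> is_degree theta (x ^+ n) (d *+ n).
Proof.
move=> th hx kx dx; elim: n => [|n IH].
  have t0 : theta 0 = 0 by apply: (addrI (theta 0)); rewrite -th // !addr0.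
  have k1 g : (g \in keys 1) = (g == 0).
    rewrite (keysP gd) ?(comp_hfrac gd _ (hfrac1 gd)); last exact: (RHs1 gd).
    by case: (g =P 0) => _; rewrite ?oner_eq0 ?eqxx.
  by split=> [|g]; [exists 0; rewrite ?k1 | rewrite k1 => /eqP->; rewrite t0].
rewrite exprS mulrS; apply: degreeM => //; [exact: (RHsX gd)|exact: supportedX].
Qed.

(* Degrees of [x ^+ n * b] grow linearly in [n]; comparing the degrees for
   [phi], [psi] and [phi + t * psi] as [n] grows bounds the [phi]-degree of the
   quotient of the [psi]-leading terms of [a] and [c]. *)
Lemma leading_quotient_bound a b c phi psi (t : nat) g0 h0 da dc :
  additive_on phi -> additive_on psi ->
  [/\ RHs a, RHs b & RHs c] -> [/\ a != 0, b != 0 & c != 0] ->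
  [/\ supported a, supported b & supported c] ->
  (forall n, RHs ((a / c) ^+ n * b)) ->
  G0 g0 -> G0 h0 ->
  is_degree psi a (psi g0) -> is_degree psi c (psi h0) ->
  is_degree (fun g => phi g + t%:Z * psi g) a (phi g0 + t%:Z * psi g0) ->
  is_degree (fun g => phi g + t%:Z * psi g) c (phi h0 + t%:Z * psi h0) ->
  is_degree phi a da -> is_degree phi c dc ->
  phi g0 - phi h0 <= da - dc.
Proof.
move=> aphi apsi [hRa hRb hRc] [a0 b0 c0] [ka kb kc] hy Gg Gh dpa dpc dta dtc dfa dfc.
pose theta g := phi g + t%:Z * psi g.
have atheta : additive_on theta.
  by move=> g h Gg' Gh'; rewrite /theta aphi // apsi // mulrDr addrACA.
have [bt hbt] := degree_exists theta hRb b0.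
have [bf hbf] := degree_exists phi hRb b0.
have [bp hbp] := degree_exists psi hRb b0.
(* The three degrees of [y] are affine in [n], and the [theta]-degree is at most the [phi]-degree
   plus [t] times the [psi]-degree. As [g0] and [h0] attain both the [psi]- and the [theta]-degrees,
   the [psi] terms multiplied by [n] cancel. *)
have key n : n%:Z * (phi g0 - phi h0 - (da - dc)) <= bf + t%:Z * bp - bt.
  pose y := (a / c) ^+ n * b.
  have ey : a ^+ n * b = c ^+ n * y by rewrite mulrA -exprMn [c * _]mulrC divfK.
  have y0 : y != 0 by rewrite mulf_neq0 // expf_neq0 // mulf_neq0 ?invr_eq0.
  have ky : supported y.
    apply: (supported_quotient _ _ (hy n) ey); rewrite ?expf_neq0 //.
    - exact: (RHsX gd).
    - by apply: supportedM => //; [exact: (RHsX gd) | exact: supportedX].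
    - exact: supportedX.
  have deg th d e f : additive_on th -> is_degree th a d -> is_degree th b e ->
      is_degree th c f -> exists2 k, is_degree th y k & k = d *+ n + e - f *+ n.
    move=> hth ha hb hc; have [k hk] := degree_exists th (hy n) y0.
    exists k => //; apply: (addrI (f *+ n)); rewrite addrCA subrr addr0.
    have h1 := degreeM hth (RHsX gd n hRc) (hy n) (supportedX hRc kc) ky
      (degreeX n hth hRc kc hc) hk.
    rewrite -/y -ey in h1; apply: degree_unique h1 _.
    by apply: degreeM => //; [exact: (RHsX gd) | exact: supportedX | exact: degreeX].
  have [kt hkt et] := deg _ _ _ _ atheta dta hbt dtc.
  have [kf hkf ef] := deg _ _ _ _ aphi dfa hbf dfc.
  have [kp hkp ep] := deg _ _ _ _ apsi dpa hbp dpc.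
  have : kt <= kf + t%:Z * kp.
    case: hkt => -[g gy <-] _; rewrite /theta; apply: lerD; first by apply: hkf.2.
    by apply: ler_wpM2l => //; apply: hkp.2.
  rewrite et ef ep -subr_ge0 => ge0; rewrite -subr_ge0 -natz.
  by apply: le_trans ge0 _; rewrite le_eqVlt; apply/orP; left; apply/eqP; ring.
rewrite -subr_le0 leNgt; apply/negP => pos.
(* A positive integer slope exceeds the constant bound once [n] exceeds the absolute value of that
   bound. *)
have := key (`|(bf + t%:Z * bp - bt)%R|.+1)%N; move: pos.
set X := (_ - _ - _); move: (_ - bt) => C X0; apply/negP; rewrite -ltNge.
have : (`|C|%N.+1)%:Z <= (`|C|%N.+1)%:Z * X by rewrite ler_peMr // -gtz0_ge1.
by lia.
Qed.
End Subgroup.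

(** Expanding [(x - u) ^+ n] gives combinations of the [x ^+ i * b] with coefficients in the
    homogeneous quotient field; the extra power of [x] makes the induction go through. It preserves
    the hypothesis on powers after a division step. *)
Lemma RHs_shift x b u : (forall n, RHs (x ^+ n * b)) -> RHs u ->
  forall n, RHs ((x - u) ^+ n * b).
Proof.
move=> hx hu n; suff h i : RHs ((x - u) ^+ n * (x ^+ i * b)) by have := h 0%N; rewrite mul1r.
elim: n i => [|n IH] i; first by rewrite mul1r.
rewrite exprSr -mulrA mulrBl mulrA -exprS mulrBr; apply: (RHsB gd) => //.
by rewrite mulrCA; apply: (RHsM gd).
Qed.

Section Box.
Variables (S : seq G) (G0 : G -> Prop) (pi : G -> {poly int}) (k : nat) (B : nat).
Hypothesis E : embedding S G0 pi k.

Let psi g := (pi g).[(2 * B).+1%:Z].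
(** For [s] equal to 1 and -1 these functionals bound the [j]-th coordinate from above and from
    below. *)
Let phi (s : int) j g := s * (pi g)`_j.
Definition boxed x := forall g, g \in keys x -> forall j, `|(pi g)`_j| <= B%:Z.

Let pi0 : pi 0 = 0.
Proof. by rewrite -[X in pi X](subrr 0) (emb_piB E) ?subrr //; apply: (emb0 E). Qed.
Let G0N g : G0 g -> G0 (- g).
Proof. by move=> hg; rewrite -sub0r; apply: (embB E) hg; apply: (emb0 E). Qed.
Let G0D g h : G0 g -> G0 h -> G0 (g + h).
Proof. by move=> hg /G0N hh; rewrite -[h]opprK; apply: (embB E). Qed.
Let piD g h : G0 g -> G0 h -> pi (g + h) = pi g + pi h.
Proof.
move=> hg hh; rewrite -{1}[h]opprK (emb_piB E) //; last exact: G0N.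
by rewrite -sub0r (emb_piB E) ?pi0 ?sub0r ?opprK //; apply: (emb0 E).
Qed.
Let psi_additive : additive_on G0 psi.
Proof. by move=> g h hg hh; rewrite /psi piD // hornerD. Qed.
Let phi_additive s j : additive_on G0 (phi s j).
Proof. by move=> g h hg hh; rewrite /phi piD // coefD mulrDr. Qed.

Let psi_inj g h : G0 g -> G0 h -> (forall j, `|(pi g)`_j| <= B%:Z) ->
  (forall j, `|(pi h)`_j| <= B%:Z) -> psi g = psi h -> g = h.
Proof.
move=> hg hh bg bh e; apply/eqP; rewrite -subr_eq0; apply/eqP/(emb_inj E).
  exact: (embB E).
apply: (@horner_radix_inj (2 * B).+1); last first.
  by rewrite (emb_piB E) // hornerD hornerN -/(psi g) e subrr.
move=> j; rewrite (emb_piB E) // coefB; have := bg j; have := bh j.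
  by move: (pi g)`_j (pi h)`_j => x y; lia.
Qed.

Let N : int := \sum_(i < k) B%:Z * (2 * B).+1%:Z ^+ i.
Let psi_lb g : (forall j, `|(pi g)`_j| <= B%:Z) -> - N <= psi g.
Proof.
move=> bg; suff : `|psi g| <= N by rewrite ler_norml => /andP[].
rewrite /psi (horner_coef_wide _ (emb_size E g)); apply: le_trans (ler_norm_sum _ _ _) _.
apply: ler_sum => i _; rewrite normrM normrX (ger0_norm (x := (2 * B).+1%:Z)) //.
by apply: ler_wpM2r; [exact: exprn_ge0 | exact: bg].
Qed.

(* On a box the weight [(2 * B).+1] makes [psi] injective, so that the leading
   term is unique; division by [c] keeps the support of [a] in the box and
   lowers its [psi]-degree, hence terminates. *)
Lemma boxed_quotient c b m a :
  [/\ RHs c, c != 0, supported G0 c & boxed c] -> [/\ RHs b, b != 0 & supported G0 b] ->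
  [/\ RHs a, supported G0 a & boxed a] -> (forall n, RHs ((a / c) ^+ n * b)) ->
  (forall g, g \in keys a -> psi g + N < m%:Z) -> RHs (a / c).
Proof.
move=> [hRc c0 kc bc] [hRb b0 kb].
elim: m a => [|m IH] a [hRa ka ba] hy hm.
  (* [psi + N] is nonnegative on the box, so for [m = 0] the numerator has no degree left and is
     zero. *)
  case: (eqVneq a 0) => [->|a0]; first by rewrite mul0r; apply: (RHs0 gd).
  have [g ga] := keys_neq0 gd hRa a0.
  by have := hm _ ga; have := psi_lb (ba _ ga); lia.
case: (eqVneq a 0) => [->|a0]; first by rewrite mul0r; apply: (RHs0 gd).
have [_ [[g0 g0a <-] hda]] := degree_exists psi hRa a0.
have [_ [[h0 h0c <-] hdc]] := degree_exists psi hRc c0.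
have Gg := ka _ g0a; have Gh := kc _ h0c.
(* The quotient of the [psi]-leading terms: [c * u] has the same leading term as [a], so [a'] loses
   it, while [a' / c] differs from [a / c] by the homogeneous [u]. *)
pose u := component a g0 / component c h0.
have hu : hfrac Rc (g0 - h0) u.
  by apply: (hfracM gd); [|apply: (hfracV gd)]; apply: (hfrac_comp gd).
have hRu := hfrac_RHs hu.
pose a' := a - c * u.
have hRcu : RHs (c * u) by apply: (RHsM gd).
have ea' : a' / c = a / c - u by rewrite mulrBl [c * u]mulrC mulfK.
have compcu g : component (c * u) (g + (g0 - h0)) = component c g * u.
  exact: (comp_mul_hfrac gd).
have keycu g : g \in keys (c * u) -> exists2 h, h \in keys c & g = h + (g0 - h0).
  rewrite (keysP gd) // => hg; exists (g - (g0 - h0)); last by rewrite subrK.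
  rewrite (keysP gd) //; apply: contraNneq hg => hg.
  by rewrite -[g](subrK (g0 - h0)) compcu hg mul0r.
have keya' g : g \in keys a' -> g \in keys a \/ exists2 h, h \in keys c & g = h + (g0 - h0).
  rewrite (keysP gd); last exact: (RHsB gd).
  rewrite (compB gd) // => hg; case: (boolP (g \in keys a)) => [|ga]; first by left.
  right; apply: keycu; rewrite (keysP gd) //; apply: contraNneq hg => ->.
  by rewrite subr0; apply: contraNT ga; rewrite (keysP gd).
have ka' : supported G0 a'.
  by move=> g /keya'[/ka//|[h /kc hh ->]]; apply: G0D => //; apply: (embB E).
(* The degrees of [c * u] are those of [c] shifted by [g0 - h0]. The bound on [phi g0 - phi h0]
   gives [phi (h + g0 - h0) <= phi h + fa - fc <= fa <= B], so the shifted support stays in the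
   box. *)
have bound (s : int) j h : (s = 1 \/ s = -1) -> h \in keys c ->
    s * (pi (h + (g0 - h0)))`_j <= B%:Z.
  move=> hs hc; have Ghc := kc _ hc.
  have sb g : g \in keys a -> phi s j g <= B%:Z.
    by move=> /ba /(_ j); rewrite /phi; move: (pi g)`_j; clear -hs; case: hs => ->; lia.
  have [fa hfa] := degree_exists (phi s j) hRa a0.
  have [fc hfc] := degree_exists (phi s j) hRc c0.
  (* On the box [phi] varies by at most [2 * B], while distinct [psi] values differ by at least 1.
     With weight [2 * B] on [psi], the [psi]-leading degree therefore stays maximal. *)
  have top x g : RHs x -> supported G0 x -> boxed x -> g \in keys x ->
      (forall h, h \in keys x -> psi h <= psi g) ->
      is_degree (fun g => phi s j g + (2 * B)%:Z * psi g) x (phi s j g + (2 * B)%:Z * psi g).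
    move=> hx kx bx gx hg; split=> [|h' hx']; first by exists g.
    case: (eqVneq h' g) => [-> //|ne].
    have lt : psi h' < psi g.
      rewrite lt_neqAle hg // andbT; apply: contra_neq ne.
      by apply: psi_inj; auto.
    have := bx _ hx' j; have := bx _ gx j.
    have : 0 <= (2 * B)%:Z * (psi g - psi h' - 1).
      by apply: mulr_ge0 => //; move: lt; move: (psi g) (psi h'); clear; lia.
    rewrite /phi; move: (psi g) (psi h') (pi g)`_j (pi h')`_j; clear -hs.
    by case: hs => ->; lia.
  have dpa : is_degree psi a (psi g0) by split=> //; exists g0.
  have dpc : is_degree psi c (psi h0) by split=> //; exists h0.
  have le := leading_quotient_bound (emb0 E) (@embB _ _ _ _ _ E) (phi_additive s j)
    psi_additive (And3 hRa hRb hRc) (And3 a0 b0 c0) (And3 ka kb kc) hy Gg Gh dpa dpc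
    (top a g0 hRa ka ba g0a hda) (top c h0 hRc kc bc h0c hdc) hfa hfc.
  have le1 : phi s j h <= fc by apply: hfc.2.
  have le2 : fa <= B%:Z by case: hfa => -[g ga <-] _; apply: sb.
  have -> : s * (pi (h + (g0 - h0)))`_j = phi s j h + (phi s j g0 - phi s j h0).
    rewrite /phi piD //; last exact: (embB E).
    by rewrite (emb_piB E) // coefD coefB mulrDr mulrBr.
  by move: le le1 le2; move: (phi s j h) (phi s j g0) (phi s j h0); clear; lia.
have ba' : boxed a'.
  move=> g /keya'[/ba//|[h hc ->]] j; rewrite ler_norml.
  have := bound 1 j h (or_introl erefl) hc; have := bound (-1) j h (or_intror erefl) hc.
  by rewrite mul1r mulN1r lerNl => -> ->.
have -> : a / c = a' / c + u by rewrite ea' subrK.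
apply: RHsD => //; apply: IH => // [||g ga'].
- by split=> //; apply: (RHsB gd).
- by rewrite ea'; apply: RHs_shift.
(* By injectivity of [psi] on the box, equality would force [g = g0], where the component of [a']
   has been cancelled. *)
suff lt : psi g < psi g0 by have := hm _ g0a; lia.
have Gg' := ka' _ ga'; have Bg := ba' _ ga'.
rewrite lt_neqAle; apply/andP; split.
  apply: contraTneq ga' => e.
  have -> : g = g0 by apply: psi_inj => //; apply: ba g0a.
  rewrite (keysP gd) ?negbK; last exact: (RHsB gd).
  rewrite (compB gd) // -{2}[g0](subrKC h0) compcu subr_eq0 mulrC divfK //.
  by rewrite -(keysP gd).
case/keya': ga' => [/hda//|[h hc ->]].
have psiB (x y : G) : G0 x -> G0 y -> psi (x - y) = psi x - psi y.
  by move=> hx hy'; rewrite /psi (emb_piB E) // hornerD hornerN.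
rewrite psi_additive ?psiB //; [|exact: kc | exact: (embB E)].
by have := hdc _ hc; lia.
Qed.
End Box.

Theorem homogeneous_field_completely_integrally_closed x b :
  R b -> b != 0 -> (forall n, RHs (x ^+ n * b)) -> RHs x.
Proof.
move=> hb b0 hx; have [a [c [ha hc c0 ex]]] := gd_frac gd x; rewrite ex in hx *.
have [hRa hRb hRc] : [/\ RHs a, RHs b & RHs c] by split; apply: (R_RHs gd).
pose S := keys a ++ keys b ++ keys c.
have [G0 [pi [k E]]] := finite_embedding (gd_torsion_free gd) S.
have [B hB] := coef_bound pi S.
have kS y : {subset keys y <= S} -> supported G0 y by move=> h g /h; apply: (emb_gen E).
have bS y : {subset keys y <= S} -> boxed pi B y by move=> h g /h; apply: hB.
have aS : {subset keys a <= S} by move=> g ga; rewrite mem_cat ga.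
have bS' : {subset keys b <= S} by move=> g ga; rewrite !mem_cat ga orbT.
have cS : {subset keys c <= S} by move=> g ga; rewrite !mem_cat ga !orbT.
pose w g := (pi g).[(2 * B).+1%:Z] + \sum_(i < k) B%:Z * (2 * B).+1%:Z ^+ i.
have [m hm] := seq_bound w (keys a).
apply: (boxed_quotient E (b := b) (m := m.+1) (B := B)) => //; try by split; auto.
by move=> g /hm; rewrite /w; lia.
Qed.
End CompletelyIntegrallyClosed.

(** * Contents of polynomials *)

Lemma coef_mul_sum (K : fieldType) (T U : Type) (s : seq T) (r : seq U)
    (c : T -> K) (d : U -> K) (m : T -> nat) (n : U -> nat) k :
  ((\sum_(t <- s) c t *: 'X^(m t)) * (\sum_(u <- r) d u *: 'X^(n u)))`_k =
  \sum_(t <- s) \sum_(u <- r | (m t + n u == k)%N) c t * d u.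
Proof.
rewrite mulr_suml coef_sum; apply: eq_bigr => t _.
rewrite mulr_sumr coef_sum [RHS]big_mkcond; apply: eq_bigr => u _.
rewrite -scalerAl -scalerAr scalerA -exprD coefZ coefXn eq_sym.
by case: eqP; rewrite ?mulr1 ?mulr0.
Qed.

Section Content.
Variables (K : fieldType) (G : zmodType).
Variables (Gam : G -> Prop) (R : K -> Prop) (Rc : G -> K -> Prop).
Hypothesis gd : graded_domain Gam R Rc.
Local Notation RHs := (RHs Rc).
Local Notation component := (component Rc).
Local Notation keys := (keys Rc).
Local Notation module := (smod (gd_subring gd)).
Local Notation pr := (@pr K R (gd_subring gd)).
Local Notation polyR := (polyR R).
Implicit Types (x y : K) (M N : module) (f g h : {poly K}).

Definition hcont x : module := \sum_(a <- keys x) pr (component x a).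

Lemma hcont_in x a : RHs x -> hcont x (component x a).
Proof.
move=> hx; have [ha|] := boolP (a \in keys x).
  by apply: (smod_sub_sum (f := fun a => pr (component x a)) ha); apply: pr_in.
by rewrite (keysP gd) // negbK => /eqP->; apply: smod0.
Qed.
Lemma hcont_min x M : (forall a, M (component x a)) -> hcont x <=: M.
Proof. by move=> h; apply: smod_sum_min => a _; apply: pr_min. Qed.
Lemma hcont_self x : RHs x -> hcont x x.
Proof.
by move=> hx; rewrite {2}(sum_comp gd hx); apply: smod_sum => a _; apply: hcont_in.
Qed.

Definition A f : module := \sum_(i <- iota 0 (size f)) hcont f`_i.

Lemma polyR_RHs f i : polyR f -> RHs f`_i.
Proof. by move=> /(_ i); apply: (R_RHs gd). Qed.

Lemma hcont_A f i : hcont f`_i <=: A f.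
Proof.
have [hi|hi] := ltnP i (size f).
  by apply: (smod_sub_sum (f := fun i => hcont f`_i)); rewrite mem_iota.
rewrite nth_default //; apply: hcont_min => a; rewrite (comp0 gd); exact: smod0.
Qed.
Lemma A_in f i a : polyR f -> A f (component f`_i a).
Proof. by move=> hf; apply/hcont_A/hcont_in/polyR_RHs. Qed.
Lemma A_self f i : polyR f -> A f f`_i.
Proof. by move=> hf; apply/hcont_A/hcont_self/polyR_RHs. Qed.
Lemma A_min f M : (forall i a, M (component f`_i a)) -> A f <=: M.
Proof. by move=> h; apply: smod_sum_min => i _; apply: hcont_min. Qed.

Lemma A_neq0 f : polyR f -> f != 0 -> A f != 0.
Proof.
move=> hf f0; apply: (@smod_neq0 _ _ _ _ (lead_coef f)); last by rewrite lead_coef_eq0.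
exact: A_self.
Qed.
Lemma A0 : A 0 = 0.
Proof. by rewrite /A size_poly0 big_nil. Qed.

Lemma Ccont_hcont x : R x -> Ccont Gam R Rc x = hcont x.
Proof.
move=> hx; have hRx := R_RHs gd hx; rewrite predeqE => z; split.
  case=> s [d [/(homogE gd)[s0 [b hs]] [hd]]]; rewrite (span_gen (gd_subring gd)).
  apply: smod_sum_min => _ /mapP[p pd ->]; apply: pr_min.
  have := hdecomp_comp gd hd pd; rewrite -[p.1](subrK b).
  rewrite (comp_mul_hfrac gd _ (Rc_hfrac gd hs)) // => <-.
  by rewrite mulfK //; apply: hcont_in.
move=> hz; have [d hd] := R_decomp gd hx; exists 1, d; split; first exact: (homog1 gd).
split; first by rewrite mulr1.
rewrite (span_gen (gd_subring gd)); apply: hcont_min hz => a.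
have [ha|] := boolP (a \in keys x); last by rewrite (keysP gd) // negbK => /eqP->; apply: smod0.
have [/mapP[p pd ->]|ad] := boolP (a \in map fst d).
  rewrite (hdecomp_comp gd hd pd).
  apply: (smod_sub_sum (f := fun x => pr x)) (pr_in _ _).
  by apply/mapP; exists p => //; rewrite divr1.
rewrite (keysP gd) // in ha; case/eqP: ha; case: hd => _ hd ->.
rewrite (compE gd); last by move=> p /hd[_]; apply: (Rc_hfrac gd).
rewrite /part big_seq_cond big1 // => p /andP[pd /eqP pa].
by case/negP: ad; rewrite -pa map_f.
Qed.

Lemma Af_A f : polyR f -> Af Gam R Rc f = A f.
Proof.
move=> hf; rewrite predeqE => z; split.
  case=> c [hc ->]; apply: smod_sum => i _; apply: (@hcont_A f i).
  by rewrite -Ccont_hcont //; apply: hc.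
suff h s : (\sum_(i <- s) hcont f`_i : module) z ->
    exists c : nat -> K, (forall i, hcont f`_i (c i)) /\ (uniq s -> z = \sum_(i <- s) c i).
  move=> /h[c [hc e]]; exists c; split=> [i _|]; first by rewrite Ccont_hcont.
  by rewrite e ?iota_uniq // -(big_mkord xpredT c) /index_iota subn0.
elim: s z => [|i s IH] z.
  rewrite big_nil => ->; exists (fun=> 0); rewrite big_nil; split=> // i; exact: smod0.
rewrite big_cons => -[u [v [hu /IH[c [hc hv]] ->]]].
exists (fun j => if j == i then u else c j); split=> [j|/= /andP[is' us]].
  by case: eqP => [->|].
rewrite big_cons eqxx hv //; congr (_ + _); apply: eq_big_seq => j js.
by case: eqP => // ji; case/negP: is'; rewrite -ji.
Qed.

(** By [hgen_A] and [hgen_poly] these are exactly the contents of polynomials over [R]; unlike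
    contents, they are visibly closed under sums and products. *)
Definition hgen M := exists s : seq K,
  (forall x, x \in s -> exists a, Rc a x) /\ M = \sum_(x <- s) pr x.

Lemma hgen_pr x a : Rc a x -> hgen (pr x).
Proof.
by move=> hx; exists [:: x]; rewrite big_seq1; split=> // y; rewrite inE => /eqP->; exists a.
Qed.
Lemma hgen1 : hgen 1.
Proof. by rewrite -pr1; apply: hgen_pr (Rc1 gd). Qed.
Lemma hgenM M N : hgen M -> hgen N -> hgen (M * N).
Proof.
move=> [s [hs ->]] [r [hr ->]]; exists [seq x * y | x <- s, y <- r]; split.
  by move=> _ /allpairsP[[x y] [/hs[a ha] /hr[b hb] ->]]; exists (a + b); apply: (RcM gd).
rewrite big_allpairs_dep mulr_suml; apply: eq_bigr => x _.
by rewrite mulr_sumr; apply: eq_bigr => y _; rewrite prM.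
Qed.
Lemma hgenD M N : hgen M -> hgen N -> hgen (M + N).
Proof.
move=> [s [hs ->]] [r [hr ->]]; exists (s ++ r); rewrite big_cat; split=> // x.
by rewrite mem_cat => /orP[/hs|/hr].
Qed.
Lemma hgenX M k : hgen M -> hgen (M ^+ k).
Proof. by move=> h; elim: k => [|k IH]; [exact: hgen1 | rewrite exprS; apply: hgenM]. Qed.
Lemma hgen0 : hgen 0.
Proof. by exists [::]; rewrite big_nil. Qed.
Lemma hgen_sum (I : eqType) (r : seq I) (F : I -> module) :
  (forall i, i \in r -> hgen (F i)) -> hgen (\sum_(i <- r) F i).
Proof.
move=> h; rewrite big_seq; apply: big_ind => //; [exact: hgen0 | exact: hgenD].
Qed.
Lemma hgen_A f : polyR f -> hgen (A f).
Proof.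
move=> hf; apply: hgen_sum => i _; apply: hgen_sum => a _.
by apply: hgen_pr; apply: (Rc_comp gd) (hf i).
Qed.

Lemma hgen_poly M : hgen M -> M != 0 -> exists h, [/\ polyR h, h != 0 & A h = M].
Proof.
move=> [s [hs eM]] M0; exists (\poly_(i < size s) s`_i).
have hR i : exists a, Rc a (\poly_(i < size s) s`_i)`_i.
  rewrite coef_poly; case: ltnP => hi; first by apply/hs/mem_nth.
  by exists 0; apply: (Rc0 gd).
have hp : polyR (\poly_(i < size s) s`_i) by move=> i; have [a] := hR i; apply: (Rc_sub gd).
have e : A (\poly_(i < size s) s`_i) = M.
  apply: smod_sub_anti.
    apply: A_min => i a; have [b hb] := hR i.
    rewrite (comp_hfrac gd _ (Rc_hfrac gd hb)); case: eqP => _; last exact: smod0.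
    rewrite coef_poly; case: ltnP => hi; last exact: smod0.
    by rewrite eM; apply: (smod_sub_sum (f := pr) (mem_nth 0 hi)); apply: pr_in.
  rewrite eM; apply: smod_sum_min => x xs; apply: pr_min.
  have := A_self (index x s) hp; rewrite coef_poly index_mem xs nth_index //.
split=> //; apply: contraNneq M0 => p0; by rewrite -e p0 A0.
Qed.

Lemma hgen_component M x a : hgen M -> M x -> M (component x a).
Proof.
move=> [s [hs eM]]; rewrite {1}eM -span_gen => -[c [hc ->]].
have hRc i : R (c i * s`_i).
  apply: (subringM (gd_subring gd)) => //.
  have [hi|hi] := ltnP i (size s); last first.
    by rewrite nth_default //; apply: (subring0 (gd_subring gd)).
  by have [b] := hs _ (mem_nth 0 hi); apply: (Rc_sub gd).
rewrite -(big_mkord xpredT (fun i => c i * s`_i)) (comp_sum gd); last first.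
  by move=> i _; apply: (R_RHs gd).
rewrite big_mkord; apply: smod_sum => i _.
have [b hb] := hs _ (mem_nth 0 (ltn_ord i)).
rewrite -[a](subrK b) (comp_mul_hfrac gd _ (Rc_hfrac gd hb)); last exact: (R_RHs gd).
apply: smodZ; first exact: (R_comp gd).
by rewrite eM; apply: (smod_sub_sum (f := pr) (mem_nth 0 (ltn_ord i))); apply: pr_in.
Qed.
Lemma hgen_sub1 M : hgen M -> M <=: (1 : module).
Proof.
move=> [s [hs ->]]; apply: smod_sum_min => x /hs[a hx]; apply: smod_sub1.
exact: (Rc_sub gd hx).
Qed.

Lemma hgen_homog_frac M : hgen M -> M != 0 -> homog_frac Gam R Rc M.
Proof.
move=> hM M0; split; [exact: (svalP M) | exact/smod_neq0P|].
exists 1; split; first exact: (homog1 gd).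
have -> : scale 1 M = M.
  rewrite predeqE => x; split=> [[y [hy ->]]|hx]; first by rewrite mul1r.
  by exists x; rewrite mul1r.
split; [exact: (svalP M) | exact: (hgen_sub1 hM)|].
by move=> r d hr hd p pd; rewrite -(hdecomp_comp gd hd pd); apply: hgen_component.
Qed.

Lemma homog_frac_component (E : K -> Prop) x :
  homog_frac Gam R Rc E -> E x -> RHs x /\ forall a, E (component x a).
Proof.
move=> [[E0 _ _] _ [s [/(homogE gd)[s0 [b hs]] [_ sR hE]]]] hx.
have hsx : scale s E (s * x) by exists x.
have hR : R (s * x) by apply: sR.
have hf := Rc_hfrac gd hs; have hRx : RHs x.
  rewrite -[x](mulKf s0); apply: (RHsM gd); last exact: (R_RHs gd).
  exact: hfrac_RHs (hfracV gd hf).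
split=> // a; have [d hd] := R_decomp gd hR.
have := comp_mul_hfrac gd a hf hRx; rewrite mulrC => e.
have [/mapP[p pd ep]|h] := boolP (a + b \in map fst d).
  have [z [hz]] := hE _ _ hsx hd _ pd.
  by rewrite -(hdecomp_comp gd hd pd) -ep e mulrC => /(mulfI s0) ->.
suff -> : component x a = 0 by [].
apply: (mulIf s0); rewrite mul0r -e; case: hd => _ hd ->.
rewrite (compE gd); last by move=> p /hd[_]; apply: (Rc_hfrac gd).
rewrite /part big_seq_cond big1 // => p /andP[pd /eqP pa].
by case/negP: h; rewrite -pa map_f.
Qed.

Lemma component_coefM f g i a : polyR f -> polyR g ->
  mem_smod (A f * A g) (component (f * g)`_i a).
Proof.
move=> hf hg; rewrite coefM (comp_sum gd); last first.
  by move=> j _; apply: (RHsM gd); apply: polyR_RHs.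
apply: smod_sum => j _.
rewrite /component (partM gd); [|exact: polyR_RHs..].
apply: smod_sum_seq => p pf _; apply: smod_sum_seq => q qg _; apply: smod_mem_mul.
  by have [-> _] := mem_dec gd (polyR_RHs j hf) pf; apply: A_in.
by have [-> _] := mem_dec gd (polyR_RHs (i - j) hg) qg; apply: A_in.
Qed.
Lemma A_mul f g : polyR f -> polyR g -> A (f * g) <=: A f * A g.
Proof. by move=> hf hg; apply: A_min => i a; apply: component_coefM. Qed.
Lemma A_add f g : polyR f -> polyR g -> A (f + g) <=: A f + A g.
Proof.
move=> hf hg; apply: A_min => i a; rewrite coefD (compD gd); try exact: polyR_RHs.
by apply: smodD; [apply: smod_addl | apply: smod_addr]; apply: A_in.
Qed.

Lemma polyR_D f g : polyR f -> polyR g -> polyR (f + g).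
Proof. by move=> hf hg i; rewrite coefD; apply: (subringD (gd_subring gd)). Qed.
Lemma polyR_M f g : polyR f -> polyR g -> polyR (f * g).
Proof.
move=> hf hg i; rewrite coefM; apply: (subring_sum (gd_subring gd)) => j _.
exact: (subringM (gd_subring gd)).
Qed.
Lemma polyR_C x : R x -> polyR x%:P.
Proof. by move=> hx i; rewrite coefC; case: eqP => _ //; apply: (subring0 (gd_subring gd)). Qed.
Lemma polyR_Xn n : polyR 'X^n.
Proof.
move=> i; rewrite coefXn; case: eqP => _; first exact: (subring1 (gd_subring gd)).
exact: (subring0 (gd_subring gd)).
Qed.

Lemma A_C x : R x -> A x%:P = hcont x.
Proof.
move=> hx; apply: smod_sub_anti.
  apply: A_min => i a; rewrite coefC; case: eqP => _; first exact/hcont_in/(R_RHs gd).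
  by rewrite (comp0 gd); apply: smod0.
by have := @hcont_A (x%:P) 0; rewrite coefC.
Qed.
Lemma hcont_homogeneous x a : Rc a x -> hcont x = pr x.
Proof.
move=> hx; apply: smod_sub_anti.
  apply: hcont_min => b; rewrite (comp_hfrac gd _ (Rc_hfrac gd hx)).
  by case: eqP => _; [apply: pr_in | apply: smod0].
by apply/pr_min/hcont_self/(R_RHs gd)/(Rc_sub gd hx).
Qed.
Lemma A1 : A 1 = 1.
Proof.
rewrite -[1]polyC1 A_C ?(hcont_homogeneous (Rc1 gd)) ?pr1 //.
exact: (subring1 (gd_subring gd)).
Qed.
Definition bikeys f : seq (G * nat) := [seq (a, i) | i <- iota 0 (size f), a <- keys f`_i].
Definition bicoef f (t : G * nat) := component f`_t.2 t.1.

Lemma mem_bikeys f a i : polyR f -> ((a, i) \in bikeys f) = (component f`_i a != 0).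
Proof.
move=> hf; rewrite -(keysP gd); last exact: polyR_RHs.
apply/idP/idP => [/allpairsPdep[j [b [_ hb [-> ->]]]] //|ha].
apply/allpairsPdep; exists i, a; split=> //; rewrite mem_iota /= add0n ltnNge.
apply: contraTN ha => hi.
by rewrite nth_default // (keysP gd) ?(comp0 gd) ?eqxx //; apply: (RHs0 gd).
Qed.
Lemma bikeys_uniq f : uniq (bikeys f).
Proof.
apply: allpairs_uniq_dep; [exact: iota_uniq | by move=> i _; apply: (keys_uniq gd)|].
by move=> [i a] [j b] _ _ /= [-> ->].
Qed.
Lemma sum_bikeys f : polyR f -> f = \sum_(t <- bikeys f) bicoef f t *: 'X^(t.2).
Proof.
move=> hf; rewrite big_allpairs_dep /bicoef /= -[LHS]coefK poly_def.
rewrite -(big_mkord xpredT (fun i => f`_i *: 'X^i)) /index_iota subn0.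
by apply: eq_bigr => i _; rewrite {1}(sum_comp gd (polyR_RHs i hf)) scaler_suml.
Qed.

(** The term of degree [a] in the coefficient of [X^i] is moved to the single exponent [w (a, i)].
    Injectivity of [w] keeps the contents of [f] and [g]. Faithfulness on sums makes each
    coefficient of [F * H] either zero or one component of one coefficient of [f * g]. *)
Lemma content_linearize f g : polyR f -> polyR g ->
  exists F H : {poly K}, [/\ cont (gd_subring gd) F = A f, cont (gd_subring gd) H = A g
    & cont (gd_subring gd) (F * H) <=: A (f * g)].
Proof.
move=> hf hg; pose lift (t : G * nat) : G * int := (t.1, t.2%:Z).
have tf n (x : G * int) : (0 < n)%N -> x *+ n = 0 -> x = 0.
  case: x => x i n0 h; congr pair; first apply: (gd_torsion_free gd n0).
    by have := congr1 fst h; rewrite raddfMn.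
  have /eqP : i *+ n = 0 by have := congr1 snd h; rewrite raddfMn.
  by rewrite mulrn_eq0 eqn0Ngt n0 => /eqP.
have [psi hpsi] := freiman_nat (map lift (bikeys f ++ bikeys g)) tf.
pose w t := psi (lift t).
have inS t : t \in bikeys f \/ t \in bikeys g -> lift t \in map lift (bikeys f ++ bikeys g).
  by move=> ht; apply: map_f; rewrite mem_cat; apply/orP.
have w_add t u t' u' : t \in bikeys f -> u \in bikeys g -> t' \in bikeys f -> u' \in bikeys g ->
    (w t + w u = w t' + w u')%N <-> t.1 + u.1 = t'.1 + u'.1 /\ (t.2 + u.2 = t'.2 + u'.2)%N.
  move=> h1 h2 h3 h4; rewrite /w -hpsi; auto; split=> [h|[e1 e2]].
    have e2 : t.2%:Z + u.2%:Z = t'.2%:Z + u'.2%:Z := congr1 snd h.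
    by split; [exact: (congr1 fst h) | apply/eqP; rewrite -eqz_nat !PoszD e2].
  have e2' : t.2%:Z + u.2%:Z = t'.2%:Z + u'.2%:Z by rewrite -!PoszD e2.
  by rewrite /lift; congr pair.
have w_inj t u : (t \in bikeys f /\ u \in bikeys f) \/ (t \in bikeys g /\ u \in bikeys g) ->
    w t = w u -> t = u.
  move=> htu e.
  have [ht hu] : lift t \in map lift (bikeys f ++ bikeys g)
      /\ lift u \in map lift (bikeys f ++ bikeys g) by split; apply: inS; tauto.
  (* Faithfulness on sums of two, with a common summand, gives injectivity. *)
  have [_ h] := hpsi (lift t) (lift t) (lift u) (lift t) ht ht hu ht.
  have /addIr h1 : lift t + lift t = lift u + lift t.
    by apply: h; rewrite -/(w t) -/(w u) e.
  have e1 : t.1 = u.1 := congr1 fst h1.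
  have [e2] : t.2%:Z = u.2%:Z := congr1 snd h1.
  by rewrite [t]surjective_pairing e1 e2 -surjective_pairing.
pose lin p := \sum_(t <- bikeys p) bicoef p t *: 'X^(w t).
have cont_lin p : polyR p -> {in bikeys p &, injective w} -> cont (gd_subring gd) (lin p) = A p.
  move=> hp winj; have cE n : (lin p)`_n = \sum_(t <- bikeys p | w t == n) bicoef p t.
    rewrite coef_sum [RHS]big_mkcond; apply: eq_bigr => t _.
    by rewrite coefZ coefXn eq_sym; case: eqP; rewrite ?mulr1 ?mulr0.
  apply: smod_sub_anti.
    by apply: cont_min => n; rewrite cE; apply: smod_sum => t _; apply: A_in.
  apply: A_min => i a; have [ta|] := boolP ((a, i) \in bikeys p); last first.
    by rewrite mem_bikeys // negbK => /eqP->; apply: smod0.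
  suff <- : (lin p)`_(w (a, i)) = component p`_i a by apply: cont_in.
  rewrite cE -big_filter.
  suff -> : [seq t <- bikeys p | w t == w (a, i)] = [:: (a, i)] by rewrite big_seq1.
  rewrite -[RHS](filter_pred1_uniq (bikeys_uniq p) ta); apply: eq_in_filter => t tp /=.
  by apply/eqP/eqP => [/winj->|->].
exists (lin f), (lin g); split.
- by apply: cont_lin => // t u ht hu; apply: w_inj; left.
- by apply: cont_lin => // t u ht hu; apply: w_inj; right.
apply: cont_min => n; rewrite coef_mul_sum.
have [/hasP[t0 ht0 /hasP[u0 hu0 /eqP e0]]|no] :=
  boolP (has (fun t => has (fun u => w t + w u == n)%N (bikeys g)) (bikeys f)); last first.
  rewrite big_seq big1 ?smod0 // => [|t ht]; first exact: smod0.
  rewrite big_seq_cond big1 // => u /andP[hu e]; case/negP: no.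
  by apply/hasP; exists t => //; apply/hasP; exists u.
pose a := t0.1 + u0.1; pose j := (t0.2 + u0.2)%N.
suff -> : \sum_(t <- bikeys f) \sum_(u <- bikeys g | (w t + w u == n)%N) bicoef f t * bicoef g u
    = component (f * g)`_j a by apply: A_in; apply: polyR_M.
have -> : (f * g)`_j = \sum_(t <- bikeys f)
    \sum_(u <- bikeys g | (t.2 + u.2 == j)%N) bicoef f t * bicoef g u.
  by rewrite {1}(sum_bikeys hf) {1}(sum_bikeys hg) coef_mul_sum.
pose e := [seq (t.1 + u.1, bicoef f t * bicoef g u) |
  t <- bikeys f, u <- [seq u <- bikeys g | (t.2 + u.2 == j)%N]].
have te : terms Rc e.
  move=> _ /allpairsPdep[t [u [_ _ ->]]] /=.
  by apply: (hfracM gd); apply: (hfrac_comp gd); apply: polyR_RHs.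
have -> : \sum_(t <- bikeys f) \sum_(u <- bikeys g | (t.2 + u.2 == j)%N) bicoef f t * bicoef g u
    = \sum_(p <- e) p.2.
  by rewrite [RHS]big_allpairs_dep /=; apply: eq_bigr => t _; rewrite big_filter.
rewrite (compE gd) // /part [RHS]big_mkcond [RHS]big_allpairs_dep [LHS]big_seq [RHS]big_seq.
apply: eq_bigr => t ht; rewrite big_filter -[RHS]big_mkcondr big_seq_cond [RHS]big_seq_cond.
apply: eq_bigl => u; case hu: (u \in bikeys g) => //=.
rewrite -e0; apply/eqP/andP => [/w_add[]// e1 e2|[/eqP e2 /eqP e1]].
  by rewrite e1 e2 !eqxx.
by apply/w_add.
Qed.

Lemma A_cancel f g : polyR f -> polyR g -> f != 0 ->
  exists P, [/\ hgen P, P != 0 & A f * A g * P <=: A (f * g) * P].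
Proof.
move=> hf hg f0; have [F [H [eF eH eFH]]] := content_linearize hf hg.
exists (A f ^+ (size H)); split; first exact/hgenX/hgen_A.
  by apply/smod_exp_neq0/A_neq0.
(* The bound is one more than [size H], so that the predecessor in the exponent is not truncated
   when [H] is zero. *)
have := @dedekind_mertens _ _ (gd_subring gd) F H (size H).+1 (leqnSn _).
rewrite eF eH -pred_Sn => h.
rewrite mulrC mulrA -exprSr; apply: smod_sub_trans h _.
by rewrite [X in _ <=: X]mulrC; apply: smod_mulS.
Qed.
End Content.

(** * Semistar closure and the Kronecker function ring *)

Section StarClosure.
Variables (K : fieldType) (R : K -> Prop) (hR : subring R).
Variable star : (K -> Prop) -> (K -> Prop).
Hypothesis hstar : semistar R star.
Local Notation module := (smod hR).
Implicit Types (x y : K) (M N P Q : module).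

(* [star] as an operation on submodules; its value at the zero module is junk *)
Definition closure M : module :=
  if pselect (submod R (star M)) is left h then exist _ _ h else 0.

Lemma semistarE M N : M != 0 -> N != 0 ->
  [/\ submod R (star M) /\ nonzero (star M),
      (forall x, x != 0 -> seteq (star (scale x M)) (scale x (star M))),
      (M <=: N -> subs (star M) (star N)),
      subs M (star M) & seteq (star (star M)) (star M)].
Proof. by move=> /smod_neq0P hM /smod_neq0P hN; apply: hstar (svalP M) hM (svalP N) hN. Qed.

Lemma closureE M : M != 0 -> closure M = star M :> (K -> Prop).
Proof.
move=> M0; have [[h _] _ _ _ _] := semistarE M0 M0.
by rewrite /closure; case: pselect.
Qed.
Lemma closure_ext M : M != 0 -> M <=: closure M.
Proof. by move=> M0; have [_ _ _ h _] := semistarE M0 M0; rewrite closureE. Qed.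
Lemma closure_mono M N : M != 0 -> M <=: N -> closure M <=: closure N.
Proof.
move=> M0 MN; have N0 := smod_sub_neq0 MN M0.
by have [_ _ h _ _] := semistarE M0 N0; rewrite !closureE //; apply: h.
Qed.
Lemma closure_idem M : M != 0 -> closure (closure M) = closure M.
Proof.
move=> M0; have M1 := smod_sub_neq0 (closure_ext M0) M0.
apply: smod_ext => x; rewrite closureE // {1}closureE // [in X in _ <-> X]closureE //.
by have [_ _ _ _ h] := semistarE M0 M0; apply: h.
Qed.
Lemma closure_trans M N P : N != 0 -> P != 0 ->
  M <=: closure N -> N <=: closure P -> M <=: closure P.
Proof.
move=> N0 P0 h1 h2; apply: smod_sub_trans h1 _.
by rewrite -(closure_idem P0); apply: closure_mono.
Qed.
Lemma prM_scale x M : mem_smod (pr hR x * M) = scale x M.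
Proof. by rewrite predeqE => z; apply: prM_mem. Qed.
Lemma closure_scale x M : x != 0 -> M != 0 -> closure (pr hR x * M) = pr hR x * closure M.
Proof.
move=> x0 M0; have [_ h _ _ _] := semistarE M0 M0.
have xM0 : pr hR x * M != 0 by apply: smod_mul_neq0 => //; apply: pr_neq0.
apply: smod_ext => z; rewrite closureE // !prM_scale closureE //; exact: h.
Qed.
(** For each nonzero [y] in [Q], compatibility with scaling turns [y] times the closure of [N] into
    the closure of [y N], contained in that of [N * Q]. *)
Lemma closure_mulr M N Q : N != 0 -> M <=: closure N -> M * Q <=: closure (N * Q).
Proof.
move=> N0 h; apply: smod_mulP => x y /h hx hy.
have [->|y0] := eqVneq y 0; first by rewrite mulr0; apply: smod0.
have yN0 : pr hR y * N != 0 by apply: smod_mul_neq0 => //; apply: pr_neq0.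
apply: (@closure_mono (pr hR y * N)) => //.
  by rewrite mulrC; apply: smod_mulS => //; apply: pr_min.
by rewrite closure_scale // mulrC; apply: smod_mem_mul => //; apply: pr_in.
Qed.
Lemma closure_mul M1 N1 M2 N2 : N1 != 0 -> N2 != 0 ->
  M1 <=: closure N1 -> M2 <=: closure N2 -> M1 * M2 <=: closure (N1 * N2).
Proof.
move=> N10 N20 h1 h2; have [->|M20] := eqVneq M2 0.
  by rewrite mulr0; apply: smod_sub0.
apply: (@closure_trans _ (N1 * M2)); try exact: smod_mul_neq0.
  exact: closure_mulr.
by rewrite mulrC [N1 * _]mulrC; apply: closure_mulr.
Qed.

Lemma prodmE M N : prodm M N = mem_smod (M * N). Proof. by []. Qed.

Definition finitely_generated M := exists s : seq K, M = \sum_(x <- s) pr hR x.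

Lemma fgnzP (E : K -> Prop) : fgnz R E <->
  exists M, [/\ E = M, M != 0 & finitely_generated M].
Proof.
split=> [[E0 [s hs]]|[M [-> M0 [s hs]]]].
  have eE : E = Defs.span R s by rewrite predeqE.
  exists (\sum_(x <- s) pr hR x); rewrite eE (span_gen hR) in E0 *.
  by split=> //; [apply/smod_neq0P | exists s].
split; first exact/smod_neq0P.
by exists s => x; rewrite (span_gen hR) hs.
Qed.

(** [star_a] tests [x] on the closure of [Q]; scaling and idempotence reduce this to [Q] itself. *)
Lemma star_aI M Q x : finitely_generated M -> finitely_generated Q -> M != 0 -> Q != 0 ->
  pr hR x * Q <=: closure (M * Q) -> star_a R star M x.
Proof.
move=> fM fQ M0 Q0 h; exists M; split; first by apply/fgnzP; exists M.
split=> //; exists Q; split; first by apply/fgnzP; exists Q.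
have MQ0 := smod_mul_neq0 M0 Q0.
move=> y hy; rewrite prodmE -closureE //.
have [->|x0] := eqVneq x 0; first by rewrite mul0r; apply: smod0.
rewrite -closure_idem //; apply: (closure_mono _ h).
  by apply: smod_mul_neq0 => //; apply: pr_neq0.
rewrite closure_scale //; apply: smod_mem_mul; first exact: pr_in.
by rewrite closureE.
Qed.

Lemma finitely_generated1 : finitely_generated 1.
Proof. by exists [:: 1]; rewrite big_seq1 pr1. Qed.
End StarClosure.

Lemma cross_multiply (F : fieldType) (a b c d : F) :
  b != 0 -> d != 0 -> a / b = c / d -> a * d = c * b.
Proof. by move=> b0 d0 /eqP; rewrite eqr_div // => /eqP. Qed.

Lemma bezout_of_pairs (F : fieldType) (S : F -> Prop) : subring S ->
  (forall q q', S q -> S q' -> exists d, [/\ S d, (exists2 w, S w & q = w * d),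
     (exists2 w, S w & q' = w * d) & exists2 w, S w & d = q + w * q']) ->
  bezout_subring S.
Proof.
move=> hS pair; split=> // s hs.
have [d [hd e]] : exists d, S d /\ \sum_(x <- s) pr hS x = pr hS d.
  elim: s hs => [_|x s IH hs].
    by exists 0; rewrite big_nil pr0; split=> //; apply: subring0 hS.
  have [|d [hd e]] := IH; first by move=> y ys; apply: hs; rewrite inE ys orbT.
  have [|d' [hd' [w hw ex] [w' hw' ed] [v hv ed']]] := pair x d (hs x _) hd.
    by rewrite mem_head.
  exists d'; rewrite big_cons e; split=> //; apply: smod_sub_anti.
    by apply: smod_add_min; apply: pr_min; [exists w | exists w'].
  apply: pr_min; rewrite ed'; apply: smodD.
    by apply: smod_addl; apply: pr_in.
  by apply: smod_addr; exists v.
by exists d; split=> // z; rewrite !(span_gen hS) big_seq1 e.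
Qed.

Section Kronecker.
Variables (K : fieldType) (G : zmodType).
Variables (Gam : G -> Prop) (R : K -> Prop) (Rc : G -> K -> Prop).
Hypothesis gd : graded_domain Gam R Rc.
Variable star : (K -> Prop) -> (K -> Prop).
Hypothesis hstar : semistar R star.
Let hR := gd_subring gd.
Local Notation RHs := (RHs Rc).
Local Notation component := (component Rc).
Local Notation module := (smod (gd_subring gd)).
Local Notation pr := (@pr K R (gd_subring gd)).
Local Notation polyR := (polyR R).
Local Notation A := (A gd).
Local Notation closure := (@closure K R (gd_subring gd) star).
Local Notation hgen := (@hgen K G Gam R Rc gd).
Local Notation KR := (KR Gam R Rc star).
Local Notation tofrac := (@FracField.tofrac {poly K}).
Implicit Types (x y : K) (M N Q T : module) (f g h : {poly K}).

Lemma hgen_fg M : hgen M -> finitely_generated M.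
Proof. by case=> s [_ e]; exists s. Qed.

Lemma KRP q : KR q <-> exists f g T, [/\ polyR f, polyR g & g != 0] /\
  [/\ hgen T, T != 0, q = tofrac f / tofrac g & A f * T <=: closure (A g * T)].
Proof.
split=> [[f [g [h [[hf hg hh g0 h0] [-> le]]]]]|[f [g [T [[hf hg g0] [hT T0 -> le]]]]]].
  exists f, g, (A h); split=> //; split=> //; [exact: hgen_A | exact: A_neq0|].
  move: le; rewrite !(Af_A gd) // !prodmE closureE //.
  by apply: smod_mul_neq0; apply: A_neq0.
have [h [hh h0 eT]] := hgen_poly hT T0; exists f, g, h; split=> //; split=> //.
rewrite !(Af_A gd) // !prodmE -closureE ?eT //.
by apply: smod_mul_neq0 => //; apply: A_neq0.
Qed.

Lemma KR_content_sub f g : polyR f -> polyR g -> g != 0 -> A f <=: A g ->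
  KR (tofrac f / tofrac g).
Proof.
move=> hf hg g0 le; apply/KRP; exists f, g, 1; split=> //; split=> //.
- exact: hgen1.
- exact: smod1_neq0.
- by rewrite !mulr1; apply: smod_sub_trans le _; apply: (closure_ext hstar); apply: A_neq0.
Qed.
Lemma A_sub1 f : polyR f -> A f <=: (1 : module).
Proof. by move=> hf; apply: A_min => i a; apply: (R_comp gd). Qed.
Lemma KR_poly f : polyR f -> KR (tofrac f).
Proof.
move=> hf; rewrite -[tofrac f]divr1 -tofrac1; apply: KR_content_sub => //.
- by rewrite -polyC1; apply: (polyR_C gd); apply: subring1 hR.
- exact: oner_neq0.
- by rewrite A1; apply: A_sub1.
Qed.

(** Over the denominator [g * g'], the inclusion of [A (f * g')] in [A f * A g'] holds outright, but
    the denominator needs the reverse inclusion for [A g * A g']. The factor [P] supplies it and is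
    absorbed in the new multiplier. *)
Lemma KR_common q q' : KR q -> KR q' -> exists f f' g T,
  [/\ polyR f, polyR f', polyR g & g != 0] /\
  [/\ hgen T, T != 0, q = tofrac f / tofrac g, q' = tofrac f' / tofrac g
    & A f * T <=: closure (A g * T) /\ A f' * T <=: closure (A g * T)].
Proof.
move=> /KRP[f [g [T [[hf hg g0] [hT T0 -> le]]]]].
move=> /KRP[f' [g' [T' [[hf' hg' g0'] [hT' T0' -> le']]]]].
have [P [hP P0 hgg]] := A_cancel gd hg hg' g0.
have gT0 : A g * T != 0 by apply: smod_mul_neq0 => //; apply: A_neq0.
have gT0' : A g' * T' != 0 by apply: smod_mul_neq0 => //; apply: A_neq0.
have gg0 : g * g' != 0 by rewrite mulf_neq0.
have hG : A g * A g' * P * (T * T') <=: A (g * g') * (T * T' * P).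
  have -> : A (g * g') * (T * T' * P) = A (g * g') * P * (T * T') by ring.
  exact: smod_mulS.
have nz : A g * A g' * P * (T * T') != 0.
  by do ![apply: smod_mul_neq0 => //]; apply: A_neq0.
exists (f * g'), (f' * g), (g * g'), (T * T' * P).
split; first by split=> //; apply: (polyR_M gd).
split.
- by do ![apply: hgenM => //].
- by do ![apply: smod_mul_neq0 => //].
- by rewrite !tofracM -mulf_div divff ?mulr1 // tofrac_eq0.
- by rewrite !tofracM [tofrac g * _]mulrC -mulf_div divff ?mulr1 // tofrac_eq0.
split; apply: smod_sub_trans (closure_mono hstar nz hG).
  apply: (@smod_sub_trans _ _ _ (A f * T * (A g' * T' * P))).
    have -> : A f * T * (A g' * T' * P) = A f * A g' * (T * T' * P) by ring.
    by apply: smod_mulS => //; apply: A_mul.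
  have -> : A g * A g' * P * (T * T') = A g * T * (A g' * T' * P) by ring.
  exact: (closure_mulr hstar).
apply: (@smod_sub_trans _ _ _ (A f' * T' * (A g * T * P))).
  have -> : A f' * T' * (A g * T * P) = A f' * A g * (T * T' * P) by ring.
  by apply: smod_mulS => //; apply: A_mul.
have -> : A g * A g' * P * (T * T') = A g' * T' * (A g * T * P) by ring.
exact: (closure_mulr hstar).
Qed.

Lemma KR_D q q' : KR q -> KR q' -> KR (q + q').
Proof.
move=> hq hq'; have [f [f' [g [T [[hf hf' hg g0] [hT T0 -> -> [le le']]]]]]] := KR_common hq hq'.
apply/KRP; exists (f + f'), g, T; split; first by split=> //; apply: (polyR_D gd).
split=> //; first by rewrite tofracD mulrDl.
apply: (@smod_sub_trans _ _ _ ((A f + A f') * T)).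
  by apply: smod_mulS => //; apply: A_add.
by rewrite mulrDl; apply: smod_add_min.
Qed.
Lemma KR_M q q' : KR q -> KR q' -> KR (q * q').
Proof.
move=> hq hq'; have [f [f' [g [T [[hf hf' hg g0] [hT T0 -> -> [le le']]]]]]] := KR_common hq hq'.
have [P [hP P0 hgg]] := A_cancel gd hg hg g0.
have gT0 : A g * T != 0 by apply: smod_mul_neq0 => //; apply: A_neq0.
apply/KRP; exists (f * f'), (g * g), (T * T * P); split.
  by split; [exact: (polyR_M gd) | exact: (polyR_M gd) | rewrite mulf_neq0].
split; [by do ![apply: hgenM => //] | by do ![apply: smod_mul_neq0 => //]| |].
  by rewrite !tofracM mulf_div.
have h : (A g * T) * (A g * T) * P <=: A (g * g) * (T * T * P).
  have -> : (A g * T) * (A g * T) * P = A g * A g * P * (T * T) by ring.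
  have -> : A (g * g) * (T * T * P) = A (g * g) * P * (T * T) by ring.
  exact: smod_mulS.
have n1 : A g * T * (A g * T) != 0 by apply: smod_mul_neq0.
apply: smod_sub_trans (closure_mono hstar (smod_mul_neq0 n1 P0) h).
apply: (@smod_sub_trans _ _ _ ((A f * T) * (A f' * T) * P)).
  have -> : A f * T * (A f' * T) * P = A f * A f' * (T * T * P) by ring.
  by apply: smod_mulS => //; apply: A_mul.
by apply: (closure_mulr hstar) => //; apply: (closure_mul hstar).
Qed.
Lemma KR_subring : subring KR.
Proof.
have k1 : KR 1.
  by rewrite -tofrac1; apply: KR_poly; rewrite -polyC1; apply: (polyR_C gd); apply: subring1 hR.
have kN1 : KR (-1).
  rewrite -tofrac1 -tofracN; apply: KR_poly; rewrite -polyC1 -polyCN; apply: (polyR_C gd).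
  exact: (subringN hR (subring1 hR)).
split=> // [|q q' hq hq'|]; last exact: KR_M.
  rewrite -tofrac0; apply: KR_poly => i; rewrite coef0; exact: subring0 hR.
by rewrite -mulN1r; apply: KR_D => //; apply: KR_M.
Qed.

Lemma A_gather f f' : polyR f -> polyR f' ->
  A f <=: A (f + f' * 'X^(size f)) /\ A f' <=: A (f + f' * 'X^(size f)).
Proof.
move=> hf hf'; set D := f + _.
have hD : polyR D by apply: (polyR_D gd) => //; apply: (polyR_M gd) => //; apply: (polyR_Xn gd).
split; apply: A_min => i a.
  have [hi|hi] := ltnP i (size f); last by rewrite nth_default // (comp0 gd); apply: smod0.
  by have := A_in gd i a hD; rewrite coefD coefMXn hi addr0.
have := A_in gd (i + size f) a hD; rewrite coefD coefMXn ltnNge leq_addl /= addnK.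
by rewrite nth_default ?add0r // leq_addl.
Qed.

Lemma KR_bezout_pair q q' : KR q -> KR q' ->
  exists d, [/\ KR d, (exists2 w, KR w & q = w * d), (exists2 w, KR w & q' = w * d)
   & exists2 w, KR w & d = q + w * q'].
Proof.
move=> hq hq'; have [f [f' [g [T [[hf hf' hg g0] [_ _ eq eq' _]]]]]] := KR_common hq hq'.
have [h h'] := A_gather hf hf'; set D := f + _ in h h'.
have hX : KR (tofrac 'X^(size f)) by apply: KR_poly; apply: (polyR_Xn gd).
have hD : polyR D by apply: (polyR_D gd) => //; apply: (polyR_M gd) => //; apply: (polyR_Xn gd).
have eD : tofrac D / tofrac g = q + tofrac 'X^(size f) * q'.
  by rewrite eq eq' tofracD tofracM mulrDl [_ * tofrac 'X^_]mulrC mulrA.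
(* If [D] vanishes, so do the contents of [f] and [f']; both quotients are zero and [d = 0]
   serves. *)
have [D0|D0] := eqVneq D 0.
  have z p : polyR p -> A p <=: A D -> p = 0.
    move=> hp; rewrite D0 A0 => hp0; apply/eqP; apply: contraT => p0.
    by have /eqP := A_neq0 gd hp p0; case; apply: smod_sub_anti => //; apply: smod_sub0.
  have k0 : KR 0 by case: KR_subring.
  exists 0; rewrite eq eq' (z _ hf h) (z _ hf' h') tofrac0 mul0r.
  by split=> //; [exists 0|exists 0|exists 0]; rewrite ?mul0r ?addr0.
exists (tofrac D / tofrac g); split.
- by rewrite eD; apply: KR_D => //; apply: KR_M.
- exists (tofrac f / tofrac D); first exact: KR_content_sub.
  by rewrite eq mulrA divfK // tofrac_eq0.
- exists (tofrac f' / tofrac D); first exact: KR_content_sub.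
  by rewrite eq' mulrA divfK // tofrac_eq0.
- by exists (tofrac 'X^(size f)).
Qed.

Lemma KR_bezout : bezout_subring KR.
Proof. exact: bezout_of_pairs KR_subring KR_bezout_pair. Qed.

(** * Comparison of [star_a] with the Kronecker function ring *)

Hypothesis hRH : subs (star R) (RH Gam R Rc).
Hypothesis hpres : homog_preserving Gam R Rc star.

(** The point at which preservation of homogeneity enters. *)
Lemma closure_component M x a : hgen M -> M != 0 -> closure M x ->
  closure M (component x a).
Proof.
move=> hM M0; rewrite closureE // => hx.
have hE := hpres (hgen_homog_frac hM M0).
by have [_ h] := homog_frac_component gd hE hx; apply: h.
Qed.

Lemma pr_A_min x f M : (forall i a, M (x * component f`_i a)) -> pr x * A f <=: M.
Proof.
move=> h; rewrite /A mulr_sumr; apply: smod_sum_min => i _.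
rewrite /hcont mulr_sumr; apply: smod_sum_min => a _.
by rewrite -prM; apply: pr_min.
Qed.

Lemma finite_denominator (s : seq K) :
  exists c, [/\ R c, c != 0 & forall z, z \in s -> R (c * z)].
Proof.
elim: s => [|z s [c [hc c0 hs]]].
  by exists 1; split; [exact: subring1 hR | exact: oner_neq0|].
have [u [v [hu hv v0 ez]]] := gd_frac gd z.
exists (c * v); split; [exact: (subringM hR) | by rewrite mulf_neq0|].
move=> y; rewrite inE => /predU1P[->|/hs hy].
  by rewrite ez -mulrA [v * _]mulrC divfK //; exact: (subringM hR).
by rewrite mulrAC; apply: (subringM hR).
Qed.

(* The coefficients of [b] generate a multiple of the module [Gm] witnessing [x \in M^star_a]. *)
Lemma star_a_witness M x : hgen M -> M != 0 -> star_a R star M x ->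
  exists b, [/\ polyR b, b != 0 & forall i, closure (M * A b) (x * b`_i)] /\
    (M <=: (1 : module) -> exists c, [/\ R c, c != 0 & forall n, RHs (x ^+ n * c)]).
Proof.
move=> hM M0 [_ [/(fgnzP hR)[N [-> N0 _]] [NM [_ [/(fgnzP hR)[Q [-> Q0 [s hs]]] hx]]]]].
have NQ0 := smod_mul_neq0 N0 Q0.
have {}hx y : closure Q y -> closure (N * Q) (x * y).
  by rewrite !closureE //; apply: hx.
have [c [hc c0 hcs]] := finite_denominator s.
pose b := \poly_(i < size s) (c * s`_i).
have bE i : b`_i = if (i < size s)%N then c * s`_i else 0 by rewrite coef_poly.
have hb : polyR b.
  move=> i; rewrite bE; case: ltnP => hi; last exact: subring0 hR.
  exact/hcs/mem_nth.
have QA : pr c * Q <=: A b.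
  rewrite hs mulr_sumr; apply: smod_sum_min => z zs; rewrite -prM; apply: pr_min.
  by have := A_self gd (index z s) hb; rewrite bE index_mem zs nth_index.
have cQ0 : pr c * Q != 0 by apply: smod_mul_neq0 => //; apply: pr_neq0.
have b0 : b != 0.
  apply: contra_neq cQ0 => b0; apply: smod_sub_anti; last exact: smod_sub0.
  by move: QA; rewrite b0 A0.
have A0' := A_neq0 gd hb b0.
exists b; split.
  split=> // i; rewrite bE; case: ltnP => hi; last by rewrite mulr0; apply: smod0.
  have sQ : Q s`_i by rewrite hs; apply: (smod_sub_sum (f := pr) (mem_nth 0 hi)); apply: pr_in.
  have := hx _ (closure_ext hstar Q0 sQ); rewrite mulrCA => h.
  apply: (@closure_mono _ _ hR _ hstar (pr c * (N * Q))).
  - by apply: smod_mul_neq0 => //; apply: pr_neq0.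
  - by rewrite mulrCA; apply: smod_mulS.
  - by rewrite closure_scale //; apply: smod_mem_mul => //; apply: pr_in.
(* As [N] lies in [R], multiplication by [x] maps the closure of [Q] into itself. The scalar [c]
   carries that closure into the closure of [R], which is where [hRH] is used. *)
move=> M1; have /smod_neq0P[z [zQ z0]] := Q0.
exists (c * z); split; last move=> n.
- by apply: (hgen_sub1 (hgen_A gd hb)); apply: QA; apply: smod_mem_mul => //; apply: pr_in.
- by rewrite mulf_neq0.
have NQ : N * Q <=: Q.
  by rewrite -[Q in X in _ <=: X]mul1r; apply: smod_mulS => //; apply: smod_sub_trans M1.
have hn : closure Q (x ^+ n * z).
  elim: n => [|n IH]; first by rewrite mul1r; apply: closure_ext.
  by rewrite exprS -mulrA; apply: (closure_mono hstar NQ0 NQ); apply: hx.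
apply/(RH_RHs gd)/hRH; have := @closureE _ _ hR _ hstar 1 (smod1_neq0 hR).
rewrite -[mem_smod 1]/R => <-.
apply: (@closure_mono _ _ hR _ hstar (pr c * Q)) => //.
  exact: smod_sub_trans QA (A_sub1 hb).
by rewrite closure_scale // mulrCA; apply: smod_mem_mul => //; apply: pr_in.
Qed.

(** For homogeneous [x], multiplication by [x] only shifts degrees: [x] times a component of [b_i]
    is a component of [x b_i]. Hence the content of [b] is again a witness. *)
Lemma star_a_homogeneous M x a : hgen M -> M != 0 -> Rc a x -> star_a R star M x ->
  exists Q, [/\ hgen Q, Q != 0 & pr x * Q <=: closure (M * Q)].
Proof.
move=> hM M0 hx /(star_a_witness hM M0)[b [[hb b0 h] _]].
exists (A b); split; [exact: hgen_A | exact: A_neq0|].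
apply: pr_A_min => i g.
have := comp_mul_hfrac gd g (Rc_hfrac gd hx) (polyR_RHs gd i hb).
rewrite [_ * x]mulrC => e; rewrite [x * _]mulrC -e; apply: closure_component.
- by apply: hgenM => //; apply: hgen_A.
- by apply: smod_mul_neq0 => //; apply: A_neq0.
- exact: h.
Qed.

(** One multiplier for all of [N]: the product of the witnesses of its finitely many homogeneous
    generators. *)
Lemma star_a_uniform M N : hgen M -> M != 0 -> hgen N ->
  (forall x, N x -> star_a R star M x) ->
  exists Q, [/\ hgen Q, Q != 0 & N * Q <=: closure (M * Q)].
Proof.
move=> hM M0 [s [hs eN]] hN.
have {}hN x : x \in s -> star_a R star M x.
  by move=> xs; apply: hN; rewrite eN; apply: (smod_sub_sum (f := pr) xs); apply: pr_in.
rewrite {}eN; elim: s hs hN => [|x s IH] hs hN.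
  exists 1; split; [exact: hgen1 | exact: smod1_neq0|].
  by rewrite big_nil mul0r; apply: smod_sub0.
have sub y : y \in s -> y \in x :: s by rewrite inE => ->; rewrite orbT.
have [Q [hQ Q0 le]] := IH (fun y ys => hs y (sub y ys)) (fun y ys => hN y (sub y ys)).
have [a hx] := hs _ (mem_head x s).
have [Q' [hQ' Q0' le']] := star_a_homogeneous hM M0 hx (hN _ (mem_head x s)).
have n1 := smod_mul_neq0 M0 Q0; have n2 := smod_mul_neq0 M0 Q0'.
exists (Q * Q'); split; [exact: hgenM | exact: smod_mul_neq0|].
rewrite big_cons mulrDl; apply: smod_add_min.
  have -> : pr x * (Q * Q') = pr x * Q' * Q by ring.
  have -> : M * (Q * Q') = M * Q' * Q by ring.
  exact: (closure_mulr hstar).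
by rewrite !mulrA; apply: (closure_mulr hstar).
Qed.

(** The multiplier 1 shows that [star_a] contains the closure. Conversely, the uniform multiplier
    [Q] is absorbed in the multiplier [A h * Q] allowed by [KRP]. *)
Lemma KR_star_a : seteq KR (Defs.KR Gam R Rc (star_a R star)).
Proof.
move=> q; split.
  move=> [f [g [h [hp [eq le]]]]]; exists f, g, h; split=> //; split=> // x /le.
  case: hp => hf hg hh g0 h0; rewrite !(Af_A gd) // !prodmE.
  have hM : hgen (A g * A h) by apply: hgenM; apply: hgen_A.
  have M0 : A g * A h != 0 by apply: smod_mul_neq0; apply: A_neq0.
  rewrite -closureE // => hx; apply: (star_aI hstar (Q := 1)) => //.
  - exact: hgen_fg.
  - exact: finitely_generated1.
  - exact: smod1_neq0.
  - by rewrite !mulr1; apply: pr_min.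
move=> [f [g [h [[hf hg hh g0 h0] [eq]]]]]; rewrite !(Af_A gd) // !prodmE => le.
have hM : hgen (A g * A h) by apply: hgenM; apply: hgen_A.
have M0 : A g * A h != 0 by apply: smod_mul_neq0; apply: A_neq0.
have hN : hgen (A f * A h) by apply: hgenM; apply: hgen_A.
have [Q [hQ Q0 leQ]] := star_a_uniform hM M0 hN le.
apply/KRP; exists f, g, (A h * Q); split=> //; split=> //.
- by apply: hgenM => //; apply: hgen_A.
- by apply: smod_mul_neq0 => //; apply: A_neq0.
- by rewrite !mulrA.
Qed.

Lemma star_a_RHs M x : hgen M -> M != 0 -> star_a R star M x -> RHs x.
Proof.
move=> hM M0 /(star_a_witness hM M0)[b [_ /(_ (hgen_sub1 hM))[c [hc c0 h]]]].
exact: (homogeneous_field_completely_integrally_closed gd hc c0 h).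
Qed.

(** The given generators need not be homogeneous; their components lie in the ideal and generate
    it. *)
Lemma homogeneous_ideal_hgen (E : K -> Prop) : homog_ideal Gam R Rc E -> fgnz R E ->
  exists M, [/\ E = M, M != 0 & hgen M].
Proof.
move=> [_ ER hE] /(fgnzP hR)[M [eE M0 [s hs]]]; exists M; split=> //.
have sM x : x \in s -> M x.
  by move=> xs; rewrite hs; apply: (smod_sub_sum (f := pr) xs); apply: pr_in.
have sR x : x \in s -> R x by move=> /sM; rewrite -eE; apply: ER.
suff -> : M = \sum_(x <- s) hcont gd x.
  rewrite big_seq; apply: big_ind; [exact: hgen0 | exact: hgenD|] => x xs.
  apply: hgen_sum => a _; apply: (hgen_pr gd (a := a)).
  exact: (Rc_comp gd a (sR x xs)).
apply: smod_sub_anti.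
  rewrite hs; apply: smod_sum_min => x xs; apply: pr_min.
  apply: (smod_sub_sum (f := hcont gd) xs); apply: hcont_self; exact: (R_RHs gd (sR x xs)).
apply: smod_sum_min => x xs; apply: hcont_min => a.
have [d hd] := R_decomp gd (sR x xs).
have [/mapP[p pd ->]|ad] := boolP (a \in map fst d).
  rewrite (hdecomp_comp gd hd pd) -eE; apply: hE hd _ pd.
  by rewrite eE; apply: sM.
case: hd => _ hd ->; rewrite (compE gd); last by move=> p /hd[_]; apply: (Rc_hfrac gd).
rewrite /part big_seq_cond big1 ?smod0 // => [|p /andP[pd /eqP pa]]; first exact: smod0.
by case/negP: ad; rewrite -pa map_f.
Qed.

Section Trace.
Variables (M : module) (al : {poly K}).
Hypotheses (hM : hgen M) (M0 : M != 0) (hal : polyR al) (al0 : al != 0) (eal : A al = M).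

(** With [x = r / s], the quotient is [r / (s al)]. The coefficients of [p * r] are the [s x p_i],
    in the closure of [s M A_p] together with their components. So [A_(p r)] is bounded by that
    closure, and cancellation passes to [A_p A_r P], giving the multiplier [A_p P]. *)
Lemma star_a_KR x : star_a R star M x -> KR (cst x / tofrac al).
Proof.
move=> hx; have := star_a_RHs hM M0 hx => /(RH_RHs gd)[r [s [hr [/(homogE gd)[s0 [b hs]] ex]]]].
have [p [[hp p0 hcl] _]] := star_a_witness hM M0 hx.
have hsR : R s := Rc_sub gd hs.
have hrs : r = s * x by rewrite ex mulrCA divff // mulr1.
have [P [hP P0 hcan]] := A_cancel gd hp (polyR_C gd hr) p0.
have MA0 : M * A p != 0 by apply: smod_mul_neq0 => //; apply: A_neq0.
have sMA0 : pr s * (M * A p) != 0 by apply: smod_mul_neq0 => //; apply: pr_neq0.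
have hrp : A (p * r%:P) <=: closure (pr s * (M * A p)).
  apply: A_min => i a; apply: closure_component => //.
    by do ![apply: hgenM]; [apply: (hgen_pr gd hs) | | apply: hgen_A].
  rewrite coefMC hrs [p`_i * _]mulrC -[s * x * _]mulrA closure_scale //.
  by apply: smod_mem_mul => //; apply: pr_in.
have sal : pr s * M <=: A (s%:P * al).
  rewrite -eal; apply: pr_A_min => i a.
  have hsal : polyR (s%:P * al) by apply: (polyR_M gd) => //; apply: (polyR_C gd).
  have := A_in gd i (a + b) hsal; rewrite coefCM [s * al`_i]mulrC.
  rewrite (comp_mul_hfrac gd _ (Rc_hfrac gd hs)); last exact: (polyR_RHs gd).
  by rewrite [_ * s]mulrC.
apply/KRP; exists r%:P, (s%:P * al), (A p * P); split.
  split; [exact: (polyR_C gd) | by apply: (polyR_M gd) => //; apply: (polyR_C gd)|].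
  by rewrite mulf_neq0 // polyC_eq0.
split.
- by apply: hgenM => //; apply: hgen_A.
- by apply: smod_mul_neq0 => //; apply: A_neq0.
- rewrite /cst hrs polyCM !tofracM invfM mulrACA divff ?mul1r //.
  by rewrite tofrac_eq0 polyC_eq0.
have -> : A r%:P * (A p * P) = A p * A r%:P * P by ring.
apply: smod_sub_trans hcan _.
apply: smod_sub_trans (closure_mulr hstar (Q := P) sMA0 hrp) _.
apply: (closure_mono hstar); first exact: smod_mul_neq0.
have -> : pr s * (M * A p) * P = pr s * M * (A p * P) by ring.
exact: smod_mulS.
Qed.

(** Comparing fractions gives [g r = s al f]. Cancelling on the left bounds [r A_g P] by
    [s M A_f P]; multiplying by [T] replaces [A_f T] by the closure of [A_g T]. Division by [s]
    leaves the witness [A_g T P] for [x]. *)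
Lemma KR_star_a_mem x : RHs x -> KR (cst x / tofrac al) -> star_a R star M x.
Proof.
move=> /(RH_RHs gd)[r [s [hr [/(homogE gd)[s0 [b hs]] ex]]]].
move=> /KRP[f [g [T [[hf hg g0] [hT T0 efg le]]]]].
have hrs : r = s * x by rewrite ex mulrCA divff // mulr1.
have hsR : R s := Rc_sub gd hs.
have epoly : g * r%:P = s%:P * (al * f).
  have tg : tofrac g != 0 by rewrite tofrac_eq0.
  have tal : tofrac al != 0 by rewrite tofrac_eq0.
  have e : x%:P * g = f * al.
    apply/eqP; rewrite -tofrac_eq !tofracM; apply/eqP.
    exact: cross_multiply tal tg efg.
  by rewrite hrs polyCM mulrCA [g * _]mulrC e [f * al]mulrC.
have [P [hP P0 hcan]] := A_cancel gd hg (polyR_C gd hr) g0.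
have gT0 : A g * T != 0 by apply: smod_mul_neq0 => //; apply: A_neq0.
have hQ : hgen (A g * T * P) by do ![apply: hgenM => //]; apply: hgen_A.
have Q0 : A g * T * P != 0 by apply: smod_mul_neq0.
have key : pr r * (A g * T * P) <=: pr s * closure (M * (A g * T * P)).
  rewrite -closure_scale //; last exact: smod_mul_neq0.
  apply: (@smod_sub_trans _ _ _ (A g * A r%:P * P * T)).
    have -> : A g * A r%:P * P * T = A r%:P * (A g * T * P) by ring.
    apply: smod_mulS => //; apply: pr_min; rewrite (A_C gd hr).
    by apply: hcont_self; apply: (R_RHs gd).
  apply: (@smod_sub_trans _ _ _ (A (g * r%:P) * P * T)); first exact: smod_mulS.
  apply: (@smod_sub_trans _ _ _ (pr s * M * P * (A f * T))).
    have -> : pr s * M * P * (A f * T) = pr s * (M * A f) * P * T by ring.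
    do 2![apply: smod_mulS => //]; rewrite epoly.
    apply: smod_sub_trans (A_mul (polyR_C gd hsR) (polyR_M gd hal hf)) _.
    rewrite (A_C gd hsR) (hcont_homogeneous gd hs) -eal.
    by apply: smod_mulS => //; apply: A_mul.
  have -> : pr s * (M * (A g * T * P)) = A g * T * (pr s * M * P) by ring.
  by rewrite mulrC; apply: (closure_mulr hstar).
apply: (star_aI hstar (Q := A g * T * P)) => //; try exact: hgen_fg.
move=> _ /prM_mem[y [hy ->]].
have : mem_smod (pr s * closure (M * (A g * T * P))) (r * y).
  by apply: key; apply: smod_mem_mul => //; apply: pr_in.
move=> /prM_mem[z [hz]]; rewrite hrs -mulrA => /(mulfI s0) ->; exact: hz.
Qed.

(** [al] generates the extension of [M] to [KR]: it is a combination of its coefficients, which lie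
    in [M], and every [a] in [M] has content within [A al], so [a / al] is in [KR]. *)
Lemma ext_ideal_KR x : ext_ideal KR M (cst x) <-> KR (cst x / tofrac al).
Proof.
have tal : tofrac al != 0 by rewrite tofrac_eq0.
split=> [[n [c [a [hca ex]]]]|hx].
  rewrite ex mulr_suml; apply: (subring_sum KR_subring) => k _.
  have [hc ha] := hca k; rewrite -mulrA; apply: KR_M => //.
  have haR : R (a k) by apply: (hgen_sub1 hM).
  apply: KR_content_sub => //; first exact: (polyR_C gd).
  rewrite (A_C gd haR) eal; apply: hcont_min => g; exact: hgen_component.
exists (size al), (fun k => cst x / tofrac al * tofrac 'X^k), (fun k => al`_k); split.
  move=> k; split; first by apply: KR_M => //; apply: KR_poly; apply: (polyR_Xn gd).
  by rewrite -eal; apply: A_self.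
rewrite -[LHS](divfK tal) -[X in _ * tofrac X]coefK poly_def rmorph_sum mulr_sumr.
apply: eq_bigr => k _; rewrite -mulrA /cst -tofracM; congr (_ * tofrac _).
by rewrite -mul_polyC mulrC.
Qed.
End Trace.
End Kronecker.

Theorem theorem2p10 (K : fieldType) (G : zmodType) (Gam : G -> Prop)
    (R : K -> Prop) (Rc : G -> K -> Prop)
    (star : (K -> Prop) -> (K -> Prop)) :
  graded_domain Gam R Rc ->
  semistar R star ->
  subs (star R) (RH Gam R Rc) -> ~ subs (RH Gam R Rc) (star R) ->
  homog_preserving Gam R Rc star ->
  [/\ seteq (KR Gam R Rc star) (KR Gam R Rc (star_a R star)),
      bezout_subring (KR Gam R Rc star)
    & forall I : K -> Prop,
        homog_ideal Gam R Rc I -> fgnz R I ->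
        seteq (star_a R star I)
              (fun x => RH Gam R Rc x /\ ext_ideal (KR Gam R Rc star) I (cst x))].
Proof.
move=> gd hstar hRH _ hpres; split.
- exact: (KR_star_a gd hstar hRH hpres).
- exact: (KR_bezout gd hstar).
move=> I hI fI; have [M [-> M0 hM]] := homogeneous_ideal_hgen gd hI fI.
have [al [hal al0 eal]] := hgen_poly hM M0.
move=> x; rewrite (ext_ideal_KR hstar hM hal al0 eal x); split=> [hx|[hx hk]].
  split; last exact: (star_a_KR hstar hRH hpres hM M0 hal al0 eal hx).
  by apply/(RH_RHs gd); apply: (star_a_RHs hstar hRH hM M0 hx).
by apply: (KR_star_a_mem hstar hM M0 hal al0 eal _ hk); apply/(RH_RHs gd).
Qed.
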